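(* Let $(H_n)_{n\in\mathbb N}$ be a sequence of Hilbert spaces and, for each $n\in\mathbb N$, let $\|\cdot\|_{\widetilde H_n}$ be an equivalent Hilbertian norm on $H_n$ such that $$\|h\|_{H_n}\le\|h\|_{\widetilde H_n}\le\mathcal C_n\|h\|_{H_n},\qquad h\in H_n,$$ where $\mathcal C_n:=\mathcal C_{H_n}(\|\cdot\|_{\widetilde H_n})$. Let $\widetilde H_n$ denote the underlying vector space of $H_n$ endowed with $\|\cdot\|_{\widetilde H_n}$, and set $\mathcal C:=\prod_{n\in\mathbb N}\mathcal C_n\in[1,\infty]$. Then the space of $C$-sequences in $\times_{n\in\mathbb N}\widetilde H_n$ coincides with the space of $C$-sequences in $\times_{n\in\mathbb N}H_n$ if and only if $\mathcal C<\infty$. If $\mathcal C<\infty$, then the following hold. (i) The complete tensor products $\bigotimes_{n\in\mathbb N}H_n$ and $\bigotimes_{n\in\mathbb N}\widetilde H_n$ agree as vector spaces up to equivalent norms, and $\mathcal C_{\bigotimes_{n}H_n}\bigl(\|\cdot\|_{\bigotimes_{n}\widetilde H_n}\bigr)=\mathcal C$. (ii) The set of equivalence classes of $C_0$-sequences in $\times_{n\in\mathbb N}\widetilde H_n$ coincides with the set of equivalence classes of $C_0$-sequences in $\times_{n\in\mathbb N}H_n$. Moreover, given a $C_0$-sequence $\boldsymbol y=(y_n)_{n\in\mathbb N}\in\times_{n\in\mathbb N}H_n$, the incomplete tensor products $\bigotimes_{n\in\mathbb N}^{\boldsymbol y}H_n$ and $\bigotimes_{n\in\mathbb N}^{\boldsymbol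 y}\widetilde H_n$ agree as vector spaces up to equivalent norms, and $\mathcal C_{\bigotimes_{n}^{\boldsymbol y}H_n}\bigl(\|\cdot\|_{\bigotimes_{n}^{\boldsymbol y}\widetilde H_n}\bigr)=\mathcal C$.
   Context: Hilbert spaces are complex. A Hilbertian norm is one induced by an inner product. For an equivalent Hilbertian norm $\|\cdot\|_\sharp$ on a Hilbert space $H$, $\mathcal C_H(\|\cdot\|_\sharp):=\inf\{MN:\ \|h\|\le M\|h\|_\sharp,\ \|h\|_\sharp\le N\|h\|\text{ for all }h\in H\}$. Products: for $(z_n)\subset\mathbb C$, $\prod_nz_n$ converges unconditionally to $a\in\mathbb C$ if $\lim_{N\to\infty}\prod_{n=1}^Nz_{\sigma(n)}=a$ for every bijection $\sigma:\mathbb N\to\mathbb N$. Infinite products are understood unconditionally. $\prod_nz_n$ is quasi-convergent if $\prod_n|z_n|$ converges unconditionally to a finite value; its value is then the unconditional limit of $\prod_nz_n$ if it exists and $0$ otherwise. Tensor products: $(h_n)\in\times_nH_n$ is a $C$-sequence if $\prod_n\|h_n\|$ converges unconditionally to a finite value. For a $C$-sequence $(h_n)$ the elementary tensor $\bigotimes_nh_n$ is the functional $(f_n)\mapsto\prod_n\langle h_n,f_n\rangle$ (quasi-convergent product) on the set of $C$-sequences. The complete tensor product $\bigotimes_nH_n$ is the completion of the linear span of elementary tensors with inner product determined by $\langle\bigotimes_nh_n,\bigotimes_nf_n\rangle=\prod_n\langle h_n,f_n\rangle$. A $C$-sequence is a $C_0$-sequence if $\sum_n|1-\|h_n\||<\infty$;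 two $C_0$-sequences are equivalent if $\sum_n|1-\langle h_n,f_n\rangle|<\infty$ (an equivalence relation). For a $C_0$-sequence $\boldsymbol y$, the incomplete tensor product $\bigotimes_n^{\boldsymbol y}H_n$ is the closed linear span in $\bigotimes_nH_n$ of the $\bigotimes_nh_n$ with $(h_n)$ a $C_0$-sequence equivalent to $\boldsymbol y$. The same definitions apply to $(\widetilde H_n)$ with its own norms and inner products. Tensor products built from $(H_n)$ and from $(\widetilde H_n)$ are compared through the natural identification of the elementary tensors $\bigotimes_nh_n$ given by the same sequence $(h_n)$. *)

(* Defs.v *)
From HB Require Import structures.
From mathcomp Require Import all_boot all_order all_algebra.
From mathcomp Require Import sesquilinear.
From mathcomp Require Import complex.
From mathcomp Require Import all_classical all_reals all_analysis.
Set Implicit Arguments.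
Unset Strict Implicit.
Unset Printing Implicit Defensive.
Import Order.TTheory GRing.Theory Num.Theory.
Import numFieldNormedType.Exports.
Local Open Scope classical_set_scope.
Local Open Scope ring_scope.

(* A Hilbertian norm on a complex vector space is given by the inner product
   [ip : {dot V for Num.conj}] (linear in the first argument) inducing it, so that
   several Hilbertian norms can live on one vector space. *)

Section Hilbert.
Context {R : realType} {V : lmodType R[i]}.
Implicit Types (ip : {dot V for Num.conj}) (A : set V) (p q : V -> R).

Definition hnorm ip (h : V) : R := Num.sqrt (complex.Re (ip h h)).

Definition hilbert ip : Prop := forall u : nat -> V,
  (forall e : R, 0 < e -> exists N : nat, forall m n : nat,
    (N <= m)%N -> (N <= n)%N -> hnorm ip (u m - u n) < e) ->
  exists l : V, hnorm ip (u n - l) @[n --> \oo] --> (0 : R).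

Definition norm_bounds A p q (M N : R) : Prop :=
  (forall h, A h -> p h <= M * q h) /\ (forall h, A h -> q h <= N * p h).

Definition equiv_norms A p q : Prop := exists M N : R, norm_bounds A p q M N.

(* The constant C_A(q) of the norm q on the space A normed by p. *)
Definition hconst A p q : R :=
  inf [set c | exists M N : R, norm_bounds A p q M N /\ c = M * N].

Definition lspan A : set V :=
  [set v | exists (k : nat) (a : 'I_k -> R[i]) (x : 'I_k -> V),
     (forall i, A (x i)) /\ v = \sum_(i < k) a i *: x i].

Definition hclosure ip A : set V :=
  [set v | forall e : R, 0 < e -> exists2 w, A w & hnorm ip (v - w) < e].

End Hilbert.

Definition uncond_prod {K : numFieldType} (z : nat -> K) (a : K) : Prop :=
  forall s : nat -> nat, bijective s ->
    \prod_(0 <= n < N) z (s n) @[N --> \oo] --> a.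

(* The value of a quasi-convergent product. *)
Definition qprod {K : numFieldType} (z : nat -> K) : K :=
  xget 0 [set a | uncond_prod z a].

(* The unconditional product of real numbers, as an extended real; the default
   value of [xget] is irrelevant for factors >= 1. *)
Definition eprod {R : realType} (z : nat -> R) : \bar R :=
  xget 0%E [set a : \bar R | forall s : nat -> nat, bijective s ->
    (\prod_(0 <= n < N) z (s n))%:E @[N --> \oo] --> a].

Section TensorProducts.
Context {R : realType} {H : nat -> lmodType R[i]}.
Implicit Types (ip : forall n, {dot H n for Num.conj}) (h f y : forall n, H n).

Definition Cseqs ip : set (forall n, H n) :=
  [set h | exists a : R, uncond_prod (fun n => hnorm (ip n) (h n)) a].

Definition C0seqs ip : set (forall n, H n) :=
  [set h | (\sum_(0 <= n <oo) `|1 - hnorm (ip n) (h n)|%:E < +oo)%E].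

(* The complex modulus [`|z|] is valued in R[i]; its real part is the modulus
   as an element of R. *)
Definition C0_class ip y : set (forall n, H n) :=
  [set h | C0seqs ip h /\
    (\sum_(0 <= n <oo) (complex.Re `|1 - ip n (h n) (y n)|)%:E < +oo)%E].

Definition C0_classes ip : set (set (forall n, H n)) :=
  C0_class ip @` C0seqs ip.

Definition elem_tensor ip (h : {h | Cseqs ip h}) : {f | Cseqs ip f} -> R[i] :=
  fun g => qprod (fun n => ip n (sval h n) (sval g n)).

Definition elem_span ip : set ({f | Cseqs ip f} -> R[i]) :=
  lspan (range (@elem_tensor ip)).

(* A completion of the span of the elementary tensors: a Hilbert space together
   with a map [ct_inj] that is linear and isometric with dense range on this
   span ([ct_inj] is irrelevant outside of it). Completions are unique up to a
   unique isometric isomorphism compatible with the [ct_inj]. *)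
Record complete_tensor ip := CompleteTensor {
  ct_space : lmodType R[i];
  ct_ip : {dot ct_space for Num.conj};
  ct_inj : ({f | Cseqs ip f} -> R[i]) -> ct_space;
  ct_hilbert : hilbert ct_ip;
  ct_linear : forall (a : R[i]) F G, elem_span F -> elem_span G ->
    ct_inj (a *: F + G) = a *: ct_inj F + ct_inj G;
  ct_isometry : forall h f : {h | Cseqs ip h},
    ct_ip (ct_inj (elem_tensor h)) (ct_inj (elem_tensor f)) =
    qprod (fun n => ip n (sval h n) (sval f n));
  ct_dense : hclosure ct_ip (ct_inj @` (@elem_span ip)) = setT
}.

Definition ct_norm ip (T : complete_tensor ip) : ct_space T -> R :=
  hnorm (ct_ip T).

Definition ct_elem ip (T : complete_tensor ip) h (hC : Cseqs ip h) :
  ct_space T := ct_inj T (elem_tensor (exist _ h hC)).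

(* C0-sequences are C-sequences, so [hC] below is no restriction. *)
Definition incomplete_tensor ip (T : complete_tensor ip) y :
    set (ct_space T) :=
  hclosure (ct_ip T)
    (lspan [set t | exists h (hC : Cseqs ip h),
       C0_class ip y h /\ t = ct_elem T hC]).

Definition natural_ident ip ipt (T : complete_tensor ip)
    (Tt : complete_tensor ipt) (Phi : ct_space T -> ct_space Tt) : Prop :=
  forall h (hC : Cseqs ip h) (hCt : Cseqs ipt h),
    Phi (ct_elem T hC) = ct_elem Tt hCt.

End TensorProducts.

Arguments ct_norm {R H ip} T _.
Arguments ct_elem {R H ip} T {h} hC.
Arguments incomplete_tensor {R H ip} T y _.
Arguments natural_ident {R H ip ipt} T Tt Phi.

(* Main.v *)
Require Import Defs.
From HB Require Import structures.
From mathcomp Require Import all_boot all_order all_algebra.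
From mathcomp Require Import sesquilinear.
From mathcomp Require Import spectral.
From mathcomp Require Import complex.
From mathcomp Require Import all_classical all_reals all_analysis.
From mathcomp Require Import ring lra.
Set Implicit Arguments.
Unset Strict Implicit.
Unset Printing Implicit Defensive.
Import Order.TTheory GRing.Theory Num.Theory.
Import numFieldNormedType.Exports.
Local Open Scope classical_set_scope.
Local Open Scope ring_scope.

(** Write [p_n] and [q_n] for the two norms on [H n], [c_n] for the constant of
    [q_n] relative to [p_n] and [K] for the product of the [c_n].  Since [c_n] is
    an infimum of products [M * N], the bounds [p_n <= q_n <= c_n p_n] cannot be
    improved: the ratio [q_n / p_n] takes values arbitrarily close to 1 and to
    [c_n] ([almost_minimal], [almost_maximal]).

    C-sequences.  Along a sequence of nonzero vectors the ratios [q_n / p_n] lie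
    between 1 and [c_n]; if [K] is finite they have an unconditional product,
    which is finite and nonzero, so the products of the [p_n] and of the [q_n]
    converge together ([Cseqs_compare]).  If [K] is infinite, unit vectors with
    nearly maximal ratios form a C-sequence for [p] only ([Cseqs_neq]).

    Classes of C0-sequences.  The difference of the two inner products of [H n]
    is a positive semidefinite form bounded by [(c_n ^ 2 - 1) p_n ^ 2], hence by
    Cauchy-Schwarz the two inner products of bounded sequences differ by a
    summable sequence ([dot_summable_compare]).

    Norms of tensors.  The square of the norm of a finite sum of elementary
    tensors is a quadratic form whose matrix has as entries the products over [n]
    of the entries of Gram matrices in [H n].  For a single [n] the two Gram
    matrices satisfy [A_n <= B_n <= c_n ^ 2 A_n] in the order of positive
    semidefinite matrices, and by the Schur product theorem these inequalities
    multiply under entrywise products ([psd_hadamard_le]).  The passage to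
    infinitely many factors meets the convention that a quasi-convergent product
    is 0 when it does not converge unconditionally, even though its partial
    products may stay away from 0.  An unconditional product [z] with nonzero
    value has summable [1 - z n] ([uncond_prod_summable]); therefore the nonzero
    entries only join equivalent C0-sequences, and the infinite matrix is the
    limit of the partial ones multiplied entrywise by the 0-1 matrix of an
    equivalence relation ([gram_limit]), which is itself positive semidefinite
    ([psd_per]) and the same for both norms ([gram_rel_compare]).  This yields
    [tensor_gram_le], that is, [|x| <= |Phi x| <= K |x|] on the span of the
    elementary tensors, and [Phi] extends to the completions
    ([bilipschitz_extension]).

    Optimality of [K].  Finitely many entries of a sequence can be changed at
    will inside its class.  Making the first [N] ratios nearly maximal shows that
    the upper constant is at least the partial product of the [c_n]; making them
    nearly minimal leaves a total ratio of at most [K] divided by that partial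
    product, so the lower constant is at least 1 ([optimal_constant]). *)

(** * Unconditional products as limits along finite sets *)

Lemma perm_cat_complement (l l' : seq nat) : uniq l -> uniq l' -> {subset l <= l'} ->
  perm_eq (l ++ [seq i <- l' | i \notin l]) l'.
Proof.
move=> ul ul' ll'; apply: uniq_perm => //.
  rewrite cat_uniq ul filter_uniq // andbT; apply/hasPn => i.
  by rewrite mem_filter => /andP[].
move=> i; rewrite mem_cat mem_filter; case: (boolP (i \in l)) => //=.
by move/ll'->.
Qed.

Lemma subset_iota_bigmax (l : seq nat) : {subset l <= iota 0 (\max_(i <- l) i).+1}.
Proof.
move=> i il; rewrite mem_iota add0n ltnS /=.
by rewrite (big_rem i il) /= leq_maxl.
Qed.

(** The permutation enumerates the union of a growing chain of finite lists,
    extended alternately so as to satisfy [P] and so as to contain the next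
    integer.  It turns a failure of convergence along finite sets into a
    rearrangement that does not converge. *)
Lemma prefix_permutation (P : seq nat -> Prop) :
  (forall l, uniq l -> exists l', uniq (l ++ l') /\ P (l ++ l')) ->
  exists2 s : nat -> nat, bijective s &
    forall N, exists2 n, (N <= n)%N & P (mkseq s n).
Proof.
move=> ext.
have ext' l : exists l', uniq l -> uniq (l ++ l') /\ P (l ++ l').
  case ul: (uniq l); last by exists [::].
  by have [l' ?] := ext l ul; exists l'.
have [e eP] := choice ext'.
(* [L k] is the list reached after [k] rounds; it contains all integers below
   [k], so its size is at least [k]. *)
pose half l := l ++ e l.
pose add k l := if k \in l then l else rcons l k : seq nat.
pose L := fix L k := if k is k'.+1 then add k' (half (L k')) else [::].
have prefix_add k l : prefix l (add k l).
  by rewrite /add; case: ifP; rewrite ?prefix_refl // prefix_rcons.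
have prefix_half l : prefix l (half l) by apply: prefix_prefix.
have uL k : uniq (L k).
  elim: k => //= k IH; rewrite /add; case: ifPn => [_|nk]; first exact: (eP _ IH).1.
  by rewrite rcons_uniq nk (eP _ IH).1.
have prefL1 k : prefix (L k) (L k.+1).
  exact: prefix_trans (prefix_half _) (prefix_add _ _).
have prefL k j : (k <= j)%N -> prefix (L k) (L j).
  elim: j => [|j IH]; first by rewrite leqn0 => /eqP->; exact: prefix_refl.
  rewrite leq_eqVlt => /orP[/eqP->|]; first exact: prefix_refl.
  by move=> /IH h; exact: prefix_trans (prefL1 _).
have inL k j : (k < j)%N -> k \in L j.
  move=> /prefL/prefixP[t ->]; rewrite mem_cat /= /add; apply/orP; left.
  by case: ifP => // _; rewrite mem_rcons inE eqxx.
have sL k : (k <= size (L k))%N.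
  rewrite -{1}(size_iota 0 k); apply: uniq_leq_size; first exact: iota_uniq.
  by move=> i; rewrite mem_iota add0n => /inL.
pose s n := nth 0%N (L n.+1) n.
have nth_prefix (l l' : seq nat) n : prefix l l' -> (n < size l)%N ->
    nth 0%N l' n = nth 0%N l n.
  by move=> /prefixP[t ->] h; rewrite nth_cat h.
have sE j n : (n < size (L j))%N -> s n = nth 0%N (L j) n.
  move=> h; rewrite /s; case: (leqP j n.+1) => le.
    exact: nth_prefix (prefL _ _ le) h.
  by rewrite (nth_prefix _ _ _ (prefL _ _ (ltnW le))) // sL.
have sI : injective s.
  move=> i j.
  have li : (i < size (L (maxn i j).+1))%N.
    by apply: leq_trans (sL _); rewrite ltnS leq_maxl.
  have lj : (j < size (L (maxn i j).+1))%N.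
    by apply: leq_trans (sL _); rewrite ltnS leq_maxr.
  by rewrite (sE _ _ li) (sE _ _ lj) => /eqP; rewrite nth_uniq // => /eqP.
pose g k := index k (L k.+1).
have gK : cancel g s.
  move=> k; rewrite /g (sE k.+1); first by rewrite nth_index // inL.
  by rewrite index_mem inL.
exists s; first by exists g => // n; apply: sI; rewrite gK.
move=> N; exists (size (half (L N))).
  by apply: leq_trans (sL N) _; rewrite size_cat leq_addr.
suff -> : mkseq s (size (half (L N))) = half (L N) by exact: (eP _ (uL N)).2.
apply: (@eq_from_nth _ 0%N); rewrite size_mkseq // => n hn.
rewrite nth_mkseq // (sE N.+1); last first.
  by apply: leq_trans hn _; apply: size_prefix; exact: prefix_add.
exact: nth_prefix (prefix_add _ _) hn.
Qed.

Section UnconditionalProducts.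
Context {K : numFieldType}.
Implicit Types (z : nat -> K) (a e : K).

Lemma prod_mkseq z (s : nat -> nat) n :
  \prod_(0 <= i < n) z (s i) = \prod_(i <- mkseq s n) z i.
Proof. by rewrite /mkseq big_map /index_iota subn0. Qed.

(** Otherwise every finite set is contained in one whose product is at distance
    at least [e] from [a], and [prefix_permutation] chains such sets into the
    prefixes of a single rearrangement. *)
Lemma uncond_prod_net z a e : uncond_prod z a -> 0 < e ->
  exists n0, forall l, uniq l -> {subset iota 0 n0 <= l} ->
    `|a - \prod_(i <- l) z i| < e.
Proof.
move=> za e0; apply: contrapT => /forallNP bad.
have [l ul|s sb sP] := @prefix_permutation
    (fun l => ~ (`|a - \prod_(i <- l) z i| < e)).
  have /existsNP[l1 /not_implyP[ul1 /not_implyP[sub lbad]]] :=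
    bad (\max_(i <- l) i).+1.
  have peq : perm_eq (l ++ [seq i <- l1 | i \notin l]) l1.
    by apply: perm_cat_complement => // i /subset_iota_bigmax; exact: sub.
  exists [seq i <- l1 | i \notin l].
  by rewrite (perm_uniq peq) (perm_big _ peq).
have /cvgrPdist_lt/(_ _ e0)[N _ hN] := za s sb.
have [n Nn] := sP N; apply.
by have := hN n Nn; rewrite /= prod_mkseq.
Qed.

(** The prefixes of any rearrangement eventually contain a given initial segment. *)
Lemma net_uncond_prod z a :
  (forall e, 0 < e -> exists n0, forall l, uniq l -> {subset iota 0 n0 <= l} ->
    `|a - \prod_(i <- l) z i| < e) -> uncond_prod z a.
Proof.
move=> net s [g sK gK]; apply/cvgrPdist_lt => e /net[n0 hn0].
exists (\max_(i < n0) g i).+1 => // n /= hn; rewrite prod_mkseq; apply: hn0.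
  by rewrite map_inj_uniq ?iota_uniq //; exact: can_inj sK.
move=> i; rewrite mem_iota add0n => /= lti; apply/mapP; exists (g i) => //.
rewrite mem_iota add0n /=; apply: leq_trans hn; rewrite ltnS.
exact: (leq_bigmax (Ordinal lti)).
Qed.

Lemma uncond_prod_cvg z a : uncond_prod z a ->
  \prod_(0 <= n < N) z n @[N --> \oo] --> a.
Proof. by apply; exists id. Qed.

Lemma uncond_prod_unique z a b : uncond_prod z a -> uncond_prod z b -> a = b.
Proof.
move=> /uncond_prod_cvg ha /uncond_prod_cvg hb.
by rewrite -(cvg_lim (@norm_hausdorff _ _) ha) -(cvg_lim (@norm_hausdorff _ _) hb).
Qed.

Lemma qprodE z a : uncond_prod z a -> qprod z = a.
Proof.
move=> za; rewrite /qprod; case: xgetP => [b _|/(_ a)] //= zb.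
exact: uncond_prod_unique zb za.
Qed.

Lemma qprod_neq0 z : qprod z != 0 -> uncond_prod z (qprod z).
Proof. by rewrite /qprod; case: xgetP => [b _|_] //; rewrite eqxx. Qed.

Lemma uncond_prodM z w a b : uncond_prod z a -> uncond_prod w b ->
  uncond_prod (fun n => z n * w n) (a * b).
Proof.
move=> za wb s sb; under eq_fun do rewrite big_split /=.
by apply: cvgM; [exact: za|exact: wb].
Qed.

Lemma uncond_prodV z a : a != 0 -> uncond_prod z a ->
  uncond_prod (fun n => (z n)^-1) a^-1.
Proof.
move=> a0 za s sb; under eq_fun do rewrite prodfV.
by apply: cvgV => //; exact: za.
Qed.

Lemma uncond_prod_zero z k : z k = 0 -> uncond_prod z 0.
Proof.
move=> zk; apply: net_uncond_prod => e e0; exists k.+1 => l _ /(_ k).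
rewrite mem_iota add0n ltnSn => /(_ isT) kl.
by rewrite (big_rem k kl) /= zk mul0r subrr normr0.
Qed.

End UnconditionalProducts.

(** * The modulus of complex numbers *)

Section Modulus.
Context {R : realType}.
Implicit Types (z w : R[i]) (x : R).

(* The complex numbers carry their topology as a [numFieldType]. *)
Local Notation C := (R[i] : numFieldType).

Definition cmod z : R := complex.Re `|z|.

Lemma cmodE z : (cmod z)%:C%C = `|z|.
Proof. by rewrite /cmod RRe_real. Qed.

Lemma cmod_ge0 z : 0 <= cmod z.
Proof. by rewrite -ler0c cmodE. Qed.

Lemma cmod0 : cmod 0 = 0.
Proof. by rewrite /cmod normr0. Qed.

Lemma cmod1 : cmod 1 = 1.
Proof. by rewrite /cmod normr1. Qed.

Lemma cmod_eq0 z : (cmod z == 0) = (z == 0).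
Proof. by rewrite -(inj_eq (@complexI R)) cmodE normr_eq0. Qed.

Lemma cmodM z w : cmod (z * w) = cmod z * cmod w.
Proof. by apply: (@complexI R); rewrite cmodE normrM rmorphM /= !cmodE. Qed.

Lemma cmodN z : cmod (- z) = cmod z.
Proof. by rewrite /cmod normrN. Qed.

Lemma cmodBC z w : cmod (z - w) = cmod (w - z).
Proof. by rewrite /cmod distrC. Qed.

Lemma cmodD z w : cmod (z + w) <= cmod z + cmod w.
Proof. by rewrite -lecR rmorphD /= !cmodE ler_normD. Qed.

Lemma cmodB z w : cmod (z - w) <= cmod z + cmod w.
Proof. by rewrite -[cmod w]cmodN cmodD. Qed.

Lemma cmod_prod I (r : seq I) (F : I -> R[i]) :
  cmod (\prod_(i <- r) F i) = \prod_(i <- r) cmod (F i).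
Proof. exact: (big_morph cmod cmodM cmod1). Qed.

Lemma cmod_real x : cmod x%:C%C = `|x|.
Proof. by rewrite /cmod normc_def /= expr0n /= addr0 sqrtr_sqr. Qed.

Lemma Re_le_cmod z : `|complex.Re z| <= cmod z.
Proof. by rewrite -lecR cmodE normc_ge_Re. Qed.

Lemma Im_le_cmod z : `|complex.Im z| <= cmod z.
Proof.
rewrite -(normrN (complex.Im z)) -ReiNIm; apply: le_trans (Re_le_cmod _) _.
by rewrite cmodM [X in _ * X](_ : _ = 1) ?mulr1 // /cmod normc_def /= expr0n /= add0r
  expr1n sqrtr1.
Qed.

Lemma cmod_le_ReIm z : cmod z <= `|complex.Re z| + `|complex.Im z|.
Proof.
rewrite {1}[z]complexE (le_trans (cmodD _ _)) // cmod_real lerD2l cmodM.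
by rewrite [cmod 'i%C](_ : _ = 1) ?mul1r ?cmod_real // /cmod normc_def /= expr0n
  /= add0r expr1n sqrtr1.
Qed.

Lemma cmod_conj z : cmod (Num.conj z) = cmod z.
Proof. by rewrite /cmod norm_conjC. Qed.

Lemma cvg_cmodP (f : nat -> C) (a : C) :
  (f n @[n --> \oo] --> a) <->
  (forall e : R, 0 < e -> exists N, forall n, (N <= n)%N -> cmod (a - f n) < e).
Proof.
split=> [/cvgrPdist_lt h e e0|h].
  have [] := h e%:C%C; first by rewrite ltcR.
  by move=> N _ hN; exists N => n /hN /=; rewrite -cmodE ltcR.
apply/cvgrPdist_lt => e e0.
have eE : e = (complex.Re e)%:C%C by rewrite RRe_real // gtr0_real.
have [|N hN] := h (complex.Re e); first by rewrite -ltcR -eE.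
by exists N => // n /hN /=; rewrite eE -cmodE ltcR.
Qed.

Lemma cvg_Re (f : nat -> C) (a : C) : f n @[n --> \oo] --> a ->
  complex.Re (f n) @[n --> \oo] --> complex.Re a.
Proof.
move=> /cvg_cmodP h; apply/cvgrPdist_lt => e /h[N hN]; exists N => // n /hN /=.
by apply: le_lt_trans; rewrite -raddfB Re_le_cmod.
Qed.

Lemma cvg_cmod (f : nat -> C) (a : C) : f n @[n --> \oo] --> a ->
  cmod (f n) @[n --> \oo] --> cmod a.
Proof. by move=> fa; apply: (cvg_Re (cvg_norm fa)). Qed.

Lemma cvg_real_complex (f : nat -> R) (a : R) : f n @[n --> \oo] --> a ->
  ((f n)%:C%C : C) @[n --> \oo] --> (a%:C%C : C).
Proof.
move=> /cvgrPdist_lt h; apply/cvg_cmodP => e /h[N _ hN]; exists N => n /hN /=.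
by rewrite -rmorphB cmod_real.
Qed.

Lemma uncond_prod_cmod (z : nat -> R[i]) a :
  uncond_prod z a -> uncond_prod (fun n => cmod (z n)) (cmod a).
Proof.
move=> za s sb; under eq_fun do rewrite -cmod_prod.
by apply: cvg_cmod; exact: za.
Qed.

Lemma uncond_prod_real (x : nat -> R) a :
  uncond_prod x a -> uncond_prod (fun n => (x n)%:C%C) a%:C%C.
Proof.
move=> xa s sb; under eq_fun do rewrite -rmorph_prod.
by apply: cvg_real_complex; exact: xa.
Qed.

End Modulus.

(** * Bounded sums and products of factors at least 1 *)

Section SumsOverFiniteSets.
Context {R : realType}.
Implicit Types (u v z : nat -> R) (l : seq nat).

(** For nonnegative [u] this is summability, see [bounded_sumsP]. *)
Definition bounded_sums u : Prop :=
  exists B, forall N, \sum_(0 <= n < N) u n <= B.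

Lemma bounded_sumsP u : (forall n, 0 <= u n) ->
  (\sum_(0 <= n <oo) (u n)%:E < +oo)%E <-> bounded_sums u.
Proof.
move=> u0; split=> [|[B hB]]; last first.
  apply: (@le_lt_trans _ _ B%:E); last exact: ltry.
  apply: lime_le; first by apply: is_cvg_nneseries => n _ _; rewrite lee_fin.
  by apply: nearW => N; rewrite sumEFin lee_fin.
move=> h; exists (fine (\sum_(0 <= n <oo) (u n)%:E)) => N.
have fin : (\sum_(0 <= n <oo) (u n)%:E)%E \is a fin_num.
  rewrite ge0_fin_numE //.
  by apply: nneseries_ge0 => n _ _; rewrite lee_fin.
rewrite -lee_fin fineK // -sumEFin.
by apply: nneseries_lim_ge => n _ _; rewrite lee_fin.
Qed.

Lemma bounded_sums_le u v : (forall n, u n <= v n) ->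
  bounded_sums v -> bounded_sums u.
Proof.
move=> uv [B hB]; exists B => N; apply: le_trans (hB N).
by apply: ler_sum => n _.
Qed.

Lemma bounded_sumsD u v : bounded_sums u -> bounded_sums v ->
  bounded_sums (fun n => u n + v n).
Proof.
move=> [B hB] [D hD]; exists (B + D) => N.
by rewrite big_split /= lerD.
Qed.

Lemma bounded_sumsZ c u : 0 <= c -> bounded_sums u ->
  bounded_sums (fun n => c * u n).
Proof. by move=> c0 [B hB]; exists (c * B) => N; rewrite -mulr_sumr ler_wpM2l. Qed.

(** Finitely many terms do not matter. *)
Lemma bounded_sums_tail k u v : (forall n, 0 <= v n) ->
  (forall n, (k <= n)%N -> u n <= v n) -> bounded_sums v -> bounded_sums u.
Proof.
move=> v0 uv [B hB]; exists (\sum_(0 <= n < k) `|u n| + B) => N.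
apply: (@le_trans _ _ (\sum_(0 <= n < N) ((if (n < k)%N then `|u n| else 0) + v n))).
  apply: ler_sum => n _; case: ltnP => h; last by rewrite add0r uv.
  by rewrite (le_trans (ler_norm _)) // lerDl.
rewrite big_split /= lerD // -big_mkcond /=.
have [Nk|kN] := leqP N k; last first.
  rewrite (big_cat_nat (n := k)) //=; last exact: ltnW.
  rewrite [X in _ + X]big_nat_cond [X in _ + X]big_pred0 ?addr0; last first.
    by move=> n; case: (leqP k n); rewrite ?andbF.
  by rewrite big_mkcond; apply: ler_sum => n _; case: ifP.
rewrite (big_cat_nat (n := N) (p := k)) //= -[leLHS]addr0 lerD //.
  by rewrite big_mkcond; apply: ler_sum => n _; case: ifP.
by apply: sumr_ge0.
Qed.

Lemma sum_le_bound u B l : (forall n, 0 <= u n) ->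
  (forall N, \sum_(0 <= n < N) u n <= B) -> uniq l -> \sum_(i <- l) u i <= B.
Proof.
move=> u0 hB ul; apply: le_trans (hB (\max_(i <- l) i).+1).
rewrite /index_iota subn0.
have pe := perm_cat_complement ul (iota_uniq _ _) (@subset_iota_bigmax l).
by rewrite -(perm_big _ pe) big_cat /= lerDl sumr_ge0.
Qed.

Lemma sum_tail_small u e : (forall n, 0 <= u n) -> bounded_sums u -> 0 < e ->
  exists n0, forall l, uniq l -> (forall i, i \in l -> (n0 <= i)%N) ->
    \sum_(i <- l) u i < e.
Proof.
move=> u0 [B hB] e0.
have hs : has_sup (range (fun N => \sum_(0 <= n < N) u n)).
  by split; [exists (\sum_(0 <= n < 0) u n); exists 0%N|exists B => _ [N _ <-]].
have [_ [n0 _ <-] hn0] := sup_adherent e0 hs.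
exists n0 => l ul ln0.
have ub N : \sum_(0 <= n < N) u n <= sup (range (fun N => \sum_(0 <= n < N) u n)).
  by apply: ub_le_sup; [exact: hs.2|exists N].
have := @sum_le_bound u _ (iota 0 n0 ++ l) u0 ub.
rewrite cat_uniq iota_uniq ul andbT big_cat /=.
have -> : ~~ has (in_mem^~ (mem (iota 0 n0))) l.
  by apply/hasPn => i /ln0; rewrite mem_iota add0n /= -leqNgt.
move=> /(_ isT); move: hn0; rewrite /index_iota subn0.
by move: (sup _) => S h1 h2; lra.
Qed.

Lemma prod_ge1 z l : (forall n, 1 <= z n) -> 1 <= \prod_(i <- l) z i.
Proof.
by move=> z1; elim: l => [|i l IH]; rewrite ?big_nil // big_cons mulr_ege1.
Qed.

Lemma prod_ge1_subset z l l' : (forall n, 1 <= z n) -> uniq l -> uniq l' ->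
  {subset l <= l'} -> \prod_(i <- l) z i <= \prod_(i <- l') z i.
Proof.
move=> z1 ul ul' ll'.
rewrite -(perm_big _ (perm_cat_complement ul ul' ll')) big_cat /=.
by rewrite ler_peMr ?(le_trans ler01) ?prod_ge1.
Qed.

(** The product over a finite set grows with the set, so it converges to its
    supremum along finite sets. *)
Lemma uncond_prod_ge1 z B : (forall n, 1 <= z n) ->
  (forall N, \prod_(0 <= n < N) z n <= B) ->
  exists a, uncond_prod z a /\ forall N, \prod_(0 <= n < N) z n <= a.
Proof.
move=> z1 hB; set E := range (fun N => \prod_(0 <= n < N) z n).
have hs : has_sup E.
  by split; [exists (\prod_(0 <= n < 0) z n); exists 0%N|exists B => _ [N _ <-]].
have ub N : \prod_(0 <= n < N) z n <= sup E.
  by apply: ub_le_sup; [exact: hs.2|exists N].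
exists (sup E); split=> //; apply: net_uncond_prod => e e0.
have [_ [n0 _ <-] hn0] := sup_adherent e0 hs.
exists n0 => l ul sub.
have h1 : \prod_(i <- l) z i <= sup E.
  apply: le_trans (ub (\max_(i <- l) i).+1).
  rewrite /index_iota subn0; apply: prod_ge1_subset => //; first exact: iota_uniq.
  exact: subset_iota_bigmax.
have h2 : \prod_(0 <= n < n0) z n <= \prod_(i <- l) z i.
  rewrite /index_iota subn0; apply: prod_ge1_subset => //; exact: iota_uniq.
rewrite ger0_norm ?subr_ge0 //; move: h1 h2 hn0.
by move: (sup _) (\prod_(i <- l) _) (\prod_(_ <= i < _) _) => S a b; lra.
Qed.

(** By the same monotonicity, every rearrangement has the supremum of the partial
    products as its limit, finite or not. *)
Lemma eprod_ge1 z : (forall n, 1 <= z n) ->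
  (exists c, [/\ eprod z = c%:E, uncond_prod z c, 1 <= c &
     forall N, \prod_(0 <= n < N) z n <= c]) \/
  (eprod z = +oo%E /\ forall B, exists N, B < \prod_(0 <= n < N) z n).
Proof.
move=> z1.
have eprodE (a : \bar R) : (forall s : nat -> nat, bijective s ->
    (\prod_(0 <= n < N) z (s n))%:E @[N --> \oo] --> a) -> eprod z = a.
  move=> ha; rewrite /eprod; case: xgetP => [b _ hb|/(_ a)] //.
  have idb : bijective (@id nat) by exists id.
  have := cvg_lim (@ereal_hausdorff R) (hb _ idb).
  by rewrite (cvg_lim (@ereal_hausdorff R) (ha _ idb)) => ->.
have [[B hB]|nB] := pselect (exists B, forall N, \prod_(0 <= n < N) z n <= B).
  have [a [za ua]] := uncond_prod_ge1 z1 hB.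
  left; exists a; split => //; last by have := ua 0%N; rewrite big_nil.
  apply: eprodE => s sb; apply: cvg_EFin; first exact: nearW.
  exact: za.
right; have ub B : exists N, B < \prod_(0 <= n < N) z n.
  apply: contrapT => /forallNP h; apply: nB; exists B => N.
  by rewrite leNgt; apply/negP; exact: h.
split=> //; apply: eprodE => s [g sK gK].
apply/cvgeryP/cvgryPge => A; have [n0 /ltW hn0] := ub A.
exists (\max_(i < n0) g i).+1 => // n /= hn.
apply: (le_trans hn0); rewrite (prod_mkseq z s n) /index_iota subn0.
apply: prod_ge1_subset => //; first exact: iota_uniq.
  by rewrite map_inj_uniq ?iota_uniq //; exact: can_inj sK.
move=> i; rewrite mem_iota add0n => /= lti; apply/mapP; exists (g i) => //.
rewrite mem_iota add0n /=; apply: leq_trans hn; rewrite ltnS.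
exact: (leq_bigmax (Ordinal lti)).
Qed.

End SumsOverFiniteSets.

(** * Unconditional and absolute convergence of complex products *)

Section ComplexProducts.
Context {R : realType}.
Implicit Types (z : nat -> R[i]) (a : R[i]) (l : seq nat).

Lemma prod_sub1_le z l : \sum_(i <- l) cmod (1 - z i) <= 2^-1 ->
  cmod (\prod_(i <- l) z i - 1) <= 2 * \sum_(i <- l) cmod (1 - z i).
Proof.
elim: l => [|i l IH]; first by rewrite !big_nil subrr cmod0 mulr0.
rewrite !big_cons; set S := \sum_(j <- l) _; set P := \prod_(j <- l) _ => hS.
have u0 : 0 <= cmod (1 - z i) by exact: cmod_ge0.
have S0 : 0 <= S by apply: sumr_ge0 => j _; exact: cmod_ge0.
have hP : cmod (P - 1) <= 2 * S by apply: IH; rewrite -/S; lra.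
have -> : z i * P - 1 = (z i - 1) * (P - 1) + (P - 1) + (z i - 1) by ring.
apply: le_trans (cmodD _ _) _; apply: le_trans (lerD (cmodD _ _) (lexx _)) _.
rewrite cmodM (cmodBC (z i)).
move: hS u0 S0 hP; move: (cmod (1 - z i)) (cmod (P - 1)) S => u p S hS u0 S0 hP.
have : u * p <= u * 1 by apply: ler_wpM2l => //; lra.
by lra.
Qed.

Lemma real_cauchy_cvg (x : nat -> R) :
  (forall e, 0 < e -> exists N, forall n, (N <= n)%N -> `|x N - x n| < e) ->
  exists l : R, x n @[n --> \oo] --> l.
Proof.
move=> h; apply/cvg_ex/cauchy_cvgP/cauchy_exP => e /= /h[N hN].
by exists (x N); exists N => // n /= /hN.
Qed.

(** By [prod_sub1_le], adding factors to a long enough initial segment hardly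
    changes the product.  So the products over finite sets are Cauchy, and the
    limit is found on real and imaginary parts. *)
Lemma summable_uncond_prod z : bounded_sums (fun n => cmod (1 - z n)) ->
  exists a, uncond_prod z a.
Proof.
move=> sz; have u0 n : 0 <= cmod (1 - z n) by exact: cmod_ge0.
have step (e : R) : 0 < e -> e <= 2^-1 -> exists n0, forall n, (n0 <= n)%N ->
    forall l, uniq l -> {subset iota 0 n <= l} ->
    cmod (\prod_(i <- l) z i - \prod_(i <- iota 0 n) z i) <=
      cmod (\prod_(i <- iota 0 n) z i) * (2 * e).
  move=> e0 e2; have [n0 hn0] := sum_tail_small u0 sz e0.
  exists n0 => n n0n l ul sub.
  rewrite -(perm_big _ (perm_cat_complement (iota_uniq _ _) ul sub)) big_cat /=.
  rewrite -{2}[\prod_(i <- iota 0 n) z i]mulr1 -mulrBr cmodM.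
  rewrite ler_wpM2l ?cmod_ge0 //.
  have hs : \sum_(i <- [seq i <- l | i \notin iota 0 n]) cmod (1 - z i) < e.
    apply: hn0; first by rewrite filter_uniq.
    move=> i; rewrite mem_filter => /andP[].
    by rewrite mem_iota add0n /= -leqNgt => /(leq_trans n0n).
  apply: le_trans (prod_sub1_le _) _; first exact/ltW/(lt_le_trans hs).
  by rewrite ler_pM2l // ltW.
(* Beyond [n1] a product at most doubles: this bounds all products by [M]. *)
have half_gt0 : 0 < 2^-1 :> R by rewrite invr_gt0.
have [n1 /(_ n1 (leqnn _)) hn1] := step _ half_gt0 (lexx _).
set M := 2 * cmod (\prod_(i <- iota 0 n1) z i) + 1.
have M0 : 0 < M by rewrite ltr_wpDl // mulr_ge0 // cmod_ge0.
have bdd l : uniq l -> {subset iota 0 n1 <= l} -> cmod (\prod_(i <- l) z i) <= M.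
  move=> ul sub; have := hn1 l ul sub; rewrite divff ?pnatr_eq0 // mulr1 => h.
  rewrite -[\prod_(i <- l) z i](subrK (\prod_(i <- iota 0 n1) z i)).
  by apply: le_trans (cmodD _ _) _; rewrite /M; lra.
have sub m n : (m <= n)%N -> {subset iota 0 m <= iota 0 n}.
  by move=> mn i; rewrite !mem_iota !add0n /= => /leq_trans; apply.
have net (e : R) : 0 < e -> exists n0, forall l, uniq l -> {subset iota 0 n0 <= l} ->
    cmod (\prod_(i <- l) z i - \prod_(i <- iota 0 n0) z i) < e.
  (* With this [d] the variation [M * (2 * d)] is at most [e / 2]. *)
  move=> e0; pose d := Num.min 2^-1 (e / (4 * M)).
  have d0 : 0 < d by rewrite lt_min half_gt0 divr_gt0 // mulr_gt0.
  have [|n0 hn0] := step d d0; first by rewrite ge_min lexx.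
  exists (maxn n0 n1) => l ul sl.
  apply: le_lt_trans (hn0 _ (leq_maxl _ _) l ul sl) _.
  apply: le_lt_trans (ler_wpM2r _ (bdd _ (iota_uniq _ _) (sub _ _ (leq_maxr _ _)))) _.
    by rewrite mulr_ge0 // ltW.
  have : d <= e / (4 * M) by rewrite ge_min lexx orbT.
  rewrite ler_pdivlMr ?mulr_gt0 // => h.
  have -> : M * (2 * d) = d * (4 * M) / 2 by field.
  by lra.
have cvg_part (f : R[i] -> R) : (forall w w', `|f w - f w'| <= cmod (w - w')) ->
    exists b : R, f (\prod_(i <- iota 0 n) z i) @[n --> \oo] --> b.
  move=> fL; apply: real_cauchy_cvg => e /net[n0 hn0].
  exists n0 => n n0n; rewrite distrC; apply: le_lt_trans (fL _ _) (hn0 _ _ _).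
    exact: iota_uniq.
  by move=> i; rewrite !mem_iota !add0n /= => /leq_trans; apply.
have [|b hb] := cvg_part (@complex.Re R).
  by move=> w w'; rewrite -raddfB Re_le_cmod.
have [|c hc] := cvg_part (@complex.Im R).
  by move=> w w'; rewrite -raddfB Im_le_cmod.
exists (b +i* c)%C; apply: net_uncond_prod => e e0.
have eE : e = (complex.Re e)%:C%C by rewrite RRe_real // gtr0_real.
have e0' : 0 < complex.Re e by rewrite -ltcR -eE.
have e5 : 0 < complex.Re e / 5 by rewrite divr_gt0.
have [n0 hn0] := net _ e5.
move/cvgrPdist_lt : hb => /(_ _ e5)[nb _ hb].
move/cvgrPdist_lt : hc => /(_ _ e5)[nc _ hc].
exists n0 => l ul sl; rewrite eE -cmodE ltcR.
pose n := maxn n0 (maxn nb nc); pose p := \prod_(i <- iota 0 n) z i.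
have h1 : `|b - complex.Re p| < complex.Re e / 5.
  by apply: hb; rewrite /= /n !leq_max leqnn orbT.
have h2 : `|c - complex.Im p| < complex.Re e / 5.
  by apply: hc; rewrite /= /n !leq_max leqnn !orbT.
have h3 := hn0 l ul sl.
have h4 := hn0 _ (iota_uniq 0 n) (sub _ _ (leq_maxl _ _)); rewrite -/p in h4.
have h5 : cmod ((b +i* c)%C - p) < complex.Re e / 5 + complex.Re e / 5.
  by apply: le_lt_trans (cmod_le_ReIm _) _; rewrite !raddfB /= ltrD.
set q := \prod_(i <- iota 0 n0) z i in h3 h4.
have -> : (b +i* c)%C - \prod_(i <- l) z i =
    ((b +i* c)%C - p) + (p - q) - (\prod_(i <- l) z i - q) by ring.
apply: le_lt_trans (cmodB _ _) _; apply: le_lt_trans (lerD (cmodD _ _) (lexx _)) _.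
by move: h3 h4 h5; move: (cmod _) (cmod _) (cmod _) => x1 x2 x3; lra.
Qed.

(** Adding a factor [z i] changes the difference in the modulus by [z i - 1]
    times the deviation from 1 of the product of the factors already there. *)
Lemma prod_linear_approx z l d :
  (forall l', subseq l' l -> cmod (\prod_(i <- l') z i - 1) <= d) ->
  cmod (\prod_(i <- l) z i - 1 - \sum_(i <- l) (z i - 1)) <=
    d * \sum_(i <- l) cmod (1 - z i).
Proof.
elim: l => [|i l IH] hd; first by rewrite !big_nil subrr subr0 cmod0 mulr0.
rewrite !big_cons.
set P := \prod_(j <- l) _; set S := \sum_(j <- l) (_ - _).
have -> : z i * P - 1 - (z i - 1 + S) = (z i - 1) * (P - 1) + (P - 1 - S) by ring.
apply: le_trans (cmodD _ _) _; rewrite [d * _]mulrDr lerD //; last first.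
  by apply: IH => l' sl'; apply: hd; apply: subseq_trans sl' (subseq_cons _ _).
rewrite cmodM mulrC (cmodBC (z i)) ler_wpM2r ?cmod_ge0 //.
by apply: hd; exact: subseq_cons.
Qed.

(** On the indices where the real part of [z i - 1] has a constant sign, its
    absolute values add up to the real part of a sum, which is by
    [prod_linear_approx] close to a product minus 1; likewise for the imaginary
    part.  Altogether the sum is at most [1 / 2] plus half of itself. *)
Lemma sum_cmod_le1 z l :
  (forall l', subseq l' l -> cmod (\prod_(i <- l') z i - 1) <= 8^-1) ->
  \sum_(i <- l) cmod (1 - z i) <= 1.
Proof.
move=> h; set S := \sum_(i <- l) _.
have key l' : subseq l' l -> cmod (\sum_(i <- l') (z i - 1)) <= 8^-1 + 8^-1 * S.
  move=> sl'; have h1 := @prod_linear_approx z l' 8^-1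
    (fun l'' s => h l'' (subseq_trans s sl')).
  have h2 := h l' sl'.
  have h3 : \sum_(i <- l') cmod (1 - z i) <= S.
    have [m _ ->] := subseqP sl'.
    rewrite /S; elim: (l) m => [|i r IH] [|b m] //=; rewrite ?big_nil ?big_cons //.
      by rewrite addr_ge0 ?cmod_ge0 // sumr_ge0 // => ? _; rewrite cmod_ge0.
    case: b; first by rewrite big_cons lerD2l.
    by apply: le_trans (IH m) _; rewrite lerDr cmod_ge0.
  rewrite -[X in cmod X](subKr (\prod_(i <- l') z i - 1)).
  apply: le_trans (cmodB _ _) _; apply: lerD => //.
  by apply: le_trans h1 _; rewrite ler_wpM2l // invr_ge0.
have half (f : {additive R[i] -> R}) : (forall w, `|f w| <= cmod w) ->
    \sum_(i <- l) `|f (z i - 1)| <= 2 * (8^-1 + 8^-1 * S).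
  move=> hf.
  have -> : \sum_(i <- l) `|f (z i - 1)| =
      f (\sum_(i <- [seq i <- l | 0 <= f (z i - 1)]) (z i - 1))
      - f (\sum_(i <- [seq i <- l | ~~ (0 <= f (z i - 1))]) (z i - 1)).
    rewrite !raddf_sum !big_filter.
    rewrite (bigID (fun i => 0 <= f (z i - 1))) /=; congr (_ + _).
      by apply: eq_bigr => i hi; rewrite ger0_norm.
    by apply: eq_bigr => i; rewrite -ltNge => hi; rewrite ltr0_norm.
  rewrite mulr_natl mulr2n; apply: le_trans (ler_norm _) _.
  apply: le_trans (ler_normB _ _) _; apply: lerD; apply: le_trans (hf _) _;
    apply: key; exact: filter_subseq.
have hR := half _ Re_le_cmod; have hI := half _ Im_le_cmod.
have : S <= \sum_(i <- l) `|complex.Re (z i - 1)| + \sum_(i <- l) `|complex.Im (z i - 1)|.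
  rewrite -big_split /=; apply: ler_sum => i _.
  by rewrite cmodBC; exact: cmod_le_ReIm.
by move: hR hI => /=; lra.
Qed.

(** Convergence along finite sets makes all products over finite sets of large
    indices uniformly close to 1, where [sum_cmod_le1] applies. *)
Lemma uncond_prod_summable z a : a != 0 -> uncond_prod z a ->
  bounded_sums (fun n => cmod (1 - z n)).
Proof.
move=> a0 za; have ca : 0 < cmod a by rewrite lt_def cmod_ge0 cmod_eq0 a0.
(* Two products within [a / 17] of [a] have a quotient within
   [(2 / 17) / (16 / 17) = 1 / 8] of 1. *)
have e0 : 0 < (cmod a / 17)%:C%C :> R[i] by rewrite ltcR divr_gt0.
have [n0 hn0] := uncond_prod_net za e0.
have {}hn0 l : uniq l -> {subset iota 0 n0 <= l} ->
    cmod (a - \prod_(i <- l) z i) < cmod a / 17.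
  by move=> ul sl; rewrite -ltcR cmodE; exact: hn0.
pose p := \prod_(i <- iota 0 n0) z i.
have hp : cmod (a - p) < cmod a / 17 by apply: hn0 => //; exact: iota_uniq.
have pa : cmod a * (16 / 17) <= cmod p.
  have : cmod a <= cmod (a - p) + cmod p by rewrite -{1}[a](subrK p) cmodD.
  by lra.
have small l : uniq l -> (forall i, i \in l -> (n0 <= i)%N) ->
    cmod (\prod_(i <- l) z i - 1) <= 8^-1.
  move=> ul ln0; have := hn0 (iota 0 n0 ++ l).
  rewrite cat_uniq iota_uniq ul andbT big_cat /= -/p.
  have -> : ~~ has (in_mem^~ (mem (iota 0 n0))) l.
    by apply/hasPn => i /ln0; rewrite mem_iota add0n /= -leqNgt.
  move=> /(_ isT) h; have {}h := h (fun i hi => ltac:(by rewrite mem_cat hi)).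
  have : cmod p * cmod (\prod_(i <- l) z i - 1) <= cmod p * 8^-1.
    rewrite -cmodM mulrBr mulr1.
    set P := \prod_(i <- l) z i in h *.
    have -> : p * P - p = (a - p) - (a - p * P) by ring.
    by apply: le_trans (cmodB _ _) _; lra.
  by rewrite ler_pM2l // (lt_le_trans _ pa) // mulr_gt0.
apply: (@bounded_sums_tail _ n0 _ (fun n => if (n < n0)%N then 0 else cmod (1 - z n))).
- by move=> n; case: ifP => // _; exact: cmod_ge0.
- by move=> n; rewrite ltnNge => ->.
exists 1 => N; apply: le_trans (@sum_cmod_le1 z [seq i <- index_iota 0 N | (n0 <= i)%N] _).
  rewrite [leRHS]big_filter [leRHS]big_mkcond /=; apply: ler_sum => i _.
  by case: leqP.
move=> l' sl'; apply: small.
  by apply: subseq_uniq sl' _; rewrite filter_uniq // iota_uniq.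
by move=> i /(mem_subseq sl'); rewrite mem_filter => /andP[].
Qed.

End ComplexProducts.

(** * Hilbertian norms and linear spans *)

Section HilbertianNorms.
Context {R : realType} {V : lmodType R[i]}.
Implicit Types (ip : {dot V for Num.conj}) (h f : V) (t a : R[i]).

Lemma dotC ip h f : ip h f = Num.conj (ip f h).
Proof. by rewrite hermC expr0 mul1r. Qed.

Lemma dotDl ip h f g : ip (h + f) g = ip h g + ip f g.
Proof. exact: linearDl. Qed.

Lemma dotDr ip h f g : ip g (h + f) = ip g h + ip g f.
Proof. exact: linearDr. Qed.

Lemma dotBl ip h f g : ip (h - f) g = ip h g - ip f g.
Proof. exact: linearBl. Qed.

Lemma dotBr ip h f g : ip g (h - f) = ip g h - ip g f.
Proof. exact: linearBr. Qed.

Lemma dotZl ip t h g : ip (t *: h) g = t * ip h g.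
Proof. by rewrite linearZl_LR. Qed.

Lemma dotZr ip t h g : ip g (t *: h) = Num.conj t * ip g h.
Proof. by rewrite linearZr_LR. Qed.

Lemma hnorm_sqr ip h : (hnorm ip h) ^+ 2 = complex.Re (ip h h).
Proof.
rewrite /hnorm sqr_sqrtr //.
by have := dnorm_ge0 ip h; rewrite lecE /= => /andP[].
Qed.

Lemma dot_hnorm ip h : ip h h = ((hnorm ip h) ^+ 2)%:C%C.
Proof. by rewrite hnorm_sqr RRe_real // ger0_real // dnorm_ge0. Qed.

Lemma hnorm_ge0 ip h : 0 <= hnorm ip h.
Proof. exact: sqrtr_ge0. Qed.

Lemma hnorm_eq0 ip h : (hnorm ip h == 0) = (h == 0).
Proof. by rewrite -sqrf_eq0 -(inj_eq (@complexI R)) -dot_hnorm dnorm_eq0. Qed.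

Lemma hnorm0 ip : hnorm ip 0 = 0.
Proof. by apply/eqP; rewrite hnorm_eq0. Qed.

Lemma hnorm_gt0 ip h : (0 < hnorm ip h) = (h != 0).
Proof. by rewrite lt_def hnorm_eq0 hnorm_ge0 andbT. Qed.

Lemma hnormZ ip t h : hnorm ip (t *: h) = cmod t * hnorm ip h.
Proof.
apply/eqP; rewrite -(@eqrXn2 _ 2) ?mulr_ge0 ?hnorm_ge0 ?cmod_ge0 //.
rewrite -(inj_eq (@complexI R)) -dot_hnorm dnormZ exprMn rmorphM /= -dot_hnorm.
by rewrite rmorphXn /= cmodE.
Qed.

Lemma hnormBC ip h f : hnorm ip (h - f) = hnorm ip (f - h).
Proof. by rewrite -[h - f]opprB -[- (f - h)]scaleN1r hnormZ cmodN cmod1 mul1r. Qed.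

Lemma hnorm_lin_sqr ip h f t : hnorm ip (h + t *: f) ^+ 2 =
  hnorm ip h ^+ 2 + 2 * complex.Re (t * ip f h) + cmod t ^+ 2 * hnorm ip f ^+ 2.
Proof.
rewrite -exprMn -hnormZ !hnorm_sqr dnormD !raddfD /= (dotC ip h (t *: f)) dotZl.
set z := t * _.
have -> : complex.Re (Num.conj z) = complex.Re z by case: z.
have -> : complex.Re (Num.conj (Num.conj z)) = complex.Re z by rewrite conjCK.
ring.
Qed.

(** Taking [t] to be a real multiple [- s] of the conjugate of [z] leaves a
    quadratic polynomial in [s] without negative values. *)
Lemma cauchy_schwarz_scalar (x y : R) (z : R[i]) : 0 <= x -> 0 <= y ->
  (forall t, 0 <= x + 2 * complex.Re (t * z) + cmod t ^+ 2 * y) ->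
  cmod z ^+ 2 <= x * y.
Proof.
move=> x0 y0 h; set Z := cmod z ^+ 2.
have Z0 : 0 <= Z by rewrite exprn_ge0 // cmod_ge0.
have {}h (s : R) : 0 <= x - 2 * s * Z + s ^+ 2 * Z * y.
  have := h ((- s)%:C%C * Num.conj z).
  rewrite cmodM cmod_real normrN cmod_conj exprMn real_normK ?num_real // -/Z.
  have -> : (- s)%:C%C * Num.conj z * z = (- s * Z)%:C%C.
    rewrite -mulrA (mulrC (Num.conj z)) -normCK -cmodE rmorphM rmorphXn /=.
    by rewrite -rmorphXn.
  move=> /= H; apply: le_trans H _; rewrite le_eqVlt; apply/orP; left.
  by apply/eqP; ring.
have [Z00|ZN0] := eqVneq Z 0; first by rewrite Z00 mulr_ge0.
have {}Z0 : 0 < Z by rewrite lt_def ZN0.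
(* For [y = 0] the polynomial is affine, and negative at this value of [s]. *)
have [y00|yN0] := eqVneq y 0.
  have := h ((x + 1) / (2 * Z)); rewrite y00 mulr0 addr0.
  have -> : 2 * ((x + 1) / (2 * Z)) * Z = x + 1 by field.
  by lra.
have {}y0 : 0 < y by rewrite lt_def yN0.
(* The polynomial is minimal at [y^-1]. *)
have := h y^-1.
have -> : x - 2 / y * Z + y^-1 ^+ 2 * Z * y = x - Z / y by field.
by rewrite subr_ge0 ler_pdivrMr.
Qed.

Lemma dot_cauchy_schwarz ip h f : cmod (ip h f) <= hnorm ip h * hnorm ip f.
Proof.
rewrite -(@ler_pXn2r _ 2) ?nnegrE ?mulr_ge0 ?hnorm_ge0 ?cmod_ge0 //.
rewrite mulrC exprMn; apply: cauchy_schwarz_scalar; rewrite ?sqr_ge0 // => t.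
by rewrite -hnorm_lin_sqr sqr_ge0.
Qed.

Lemma hnorm_triangle ip h f : hnorm ip (h + f) <= hnorm ip h + hnorm ip f.
Proof.
rewrite -(@ler_pXn2r _ 2) ?nnegrE ?addr_ge0 ?hnorm_ge0 //.
have := hnorm_lin_sqr ip h f 1; rewrite scale1r cmod1 expr1n !mul1r => ->.
have := le_trans (ler_norm _) (le_trans (Re_le_cmod _) (dot_cauchy_schwarz ip f h)).
by rewrite sqrrD mulr_natl (mulrC (hnorm ip h)) => ?; rewrite lerD2r lerD2l lerMn2r.
Qed.

Lemma hnorm_triangleB ip h f : hnorm ip (h - f) <= hnorm ip h + hnorm ip f.
Proof.
apply: le_trans (hnorm_triangle _ _ _) _.
by rewrite -scaleN1r hnormZ cmodN cmod1 mul1r.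
Qed.

Lemma hnorm_le_sub ip h f : hnorm ip h <= hnorm ip f + hnorm ip (h - f).
Proof. by rewrite -{1}[h](subrK f) addrC hnorm_triangle. Qed.

(** The difference of the two inner products is a positive semidefinite form,
    so the Cauchy-Schwarz inequality applies to it. *)
Lemma dot_diff_le ip ipt (c : R) :
  (forall h, hnorm ip h <= hnorm ipt h /\ hnorm ipt h <= c * hnorm ip h) ->
  forall h f, cmod (ipt h f - ip h f) <= (c ^+ 2 - 1) * (hnorm ip h * hnorm ip f).
Proof.
move=> hpq h f; pose D g := hnorm ipt g ^+ 2 - hnorm ip g ^+ 2.
have D0 g : 0 <= D g.
  by rewrite subr_ge0 ler_pXn2r ?nnegrE ?hnorm_ge0 //; exact: (hpq g).1.
have Dc g : D g <= (c ^+ 2 - 1) * hnorm ip g ^+ 2.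
  rewrite /D mulrBl mul1r lerD2r -exprMn ler_pXn2r ?nnegrE ?hnorm_ge0 //.
    exact: (hpq g).2.
  exact: le_trans (hnorm_ge0 ipt g) (hpq g).2.
have cs : cmod (ipt h f - ip h f) ^+ 2 <= D f * D h.
  apply: cauchy_schwarz_scalar => // t.
  have := D0 (f + t *: h); rewrite /D !hnorm_lin_sqr mulrBr raddfB /=.
  by move=> H; apply: le_trans H _; rewrite le_eqVlt; apply/orP; left; apply/eqP; ring.
have [->|h0] := eqVneq h 0.
  by rewrite hnorm0 mul0r mulr0 !linear0l subrr cmod0.
have c1 : 0 <= c ^+ 2 - 1.
  have := le_trans (D0 h) (Dc h).
  by rewrite pmulr_lge0 // exprn_gt0 // hnorm_gt0.
rewrite -(@ler_pXn2r _ 2) ?nnegrE ?mulr_ge0 ?hnorm_ge0 ?cmod_ge0 //.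
apply: le_trans cs _; apply: le_trans (ler_pM (D0 f) (D0 h) (Dc f) (Dc h)) _.
by rewrite le_eqVlt; apply/orP; left; apply/eqP; ring.
Qed.

Lemma dot_sum ip k (a : 'I_k -> R[i]) (x : 'I_k -> V) :
  ip (\sum_i a i *: x i) (\sum_i a i *: x i) =
  \sum_i \sum_j a i * Num.conj (a j) * ip (x i) (x j).
Proof.
rewrite (big_morph (ip^~ _) (fun h f => dotDl ip h f _) (linear0l _ _)).
apply: eq_bigr => i _.
rewrite (big_morph (ip _) (fun h f => dotDr ip h f _) (linear0r _ _)).
by apply: eq_bigr => j _; rewrite dotZl dotZr mulrA.
Qed.

Lemma lspan_linear (A : set V) t u v : lspan A u -> lspan A v ->
  lspan A (t *: u + v).
Proof.
move=> [k [a [x [Ax ->]]]] [m [b [y [Ay ->]]]].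
exists (k + m)%N.
exists (fun i : 'I_(k + m) => match fintype.split i with inl i => t * a i | inr j => b j end).
exists (fun i : 'I_(k + m) => match fintype.split i with inl i => x i | inr j => y j end).
split; first by move=> i; case: fintype.split => j.
rewrite big_split_ord /= scaler_sumr; congr (_ + _); apply: eq_bigr => i _.
  by rewrite -[lshift m i]/(unsplit (inl i)) unsplitK scalerA.
by rewrite -[rshift k i]/(unsplit (inr i)) unsplitK.
Qed.

Lemma lspan0 (A : set V) : lspan A 0.
Proof. by exists 0%N, (fun _ => 0), (fun _ => 0); split=> [[]|] //; rewrite big_ord0. Qed.

Lemma lspan_gen (A : set V) x : A x -> lspan A x.
Proof.
by exists 1%N, (fun _ => 1), (fun _ => x); rewrite big_ord1 scale1r.
Qed.

End HilbertianNorms.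

(** * Positive semidefinite matrices and entrywise products *)

Section SchurProduct.
Context {R : realType}.

Definition psd k (A : 'M[R[i]]_k) : Prop :=
  (forall i j, A j i = Num.conj (A i j)) /\
  (forall a : 'I_k -> R[i], 0 <= \sum_i \sum_j a i * Num.conj (a j) * A i j).

(** By the spectral theorem; the eigenvalues are values of the quadratic form at
    eigenvectors. *)
Lemma psd_decomposition k (A : 'M[R[i]]_k) : psd A ->
  exists (d : 'I_k -> R[i]) (u : 'I_k -> 'I_k -> R[i]), (forall r, 0 <= d r) /\
    forall i j, A i j = \sum_r d r * (u r i * Num.conj (u r j)).
Proof.
move=> [Ah Aq]; pose P := spectralmx A; pose d := spectral_diag A.
have PU : P \is unitarymx by exact: spectral_unitarymx.
have Pu : P \in unitmx by exact: spectral_unit.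
have AE : A = invmx P *m diag_mx d *m P.
  apply/orthomx_spectralP; apply: hermitian_normalmx.
  apply/is_hermitianmxP; rewrite expr0 scale1r; apply/matrixP => i j.
  by rewrite !mxE Ah.
exists (d 0), (fun r i => Num.conj (P r i)); split; last first.
  move=> i j; rewrite {1}AE invmx_unitary // mxE; apply: eq_bigr => r _.
  by rewrite mul_mx_diag !mxE conjCK; ring.
move=> r; have -> : d 0 r = \sum_i \sum_j P r i * Num.conj (P r j) * A i j; last exact: Aq.
have : P *m A *m invmx P = diag_mx d.
  by rewrite AE !mulmxA mulmxV // mul1mx mulmxK.
move=> /matrixP/(_ r r); rewrite [in RHS]mxE eqxx mulr1n => <-.
rewrite invmx_unitary // mxE exchange_big /=; apply: eq_bigr => j _.
rewrite mxE mulr_suml; apply: eq_bigr => i _; rewrite !mxE.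
ring.
Qed.

Definition hadamard k (A B : 'M[R[i]]_k) : 'M[R[i]]_k := \matrix_(i, j) (A i j * B i j).

(** The Schur product theorem: a positive semidefinite factor is a nonnegative
    combination of rank-one matrices, and multiplying entrywise by a rank-one
    matrix only rescales the arguments of the quadratic form. *)
Lemma psd_hadamard k (A B : 'M[R[i]]_k) : psd A -> psd B -> psd (hadamard A B).
Proof.
move=> pA [Bh Bq]; split=> [i j|a]; first by rewrite !mxE pA.1 Bh rmorphM.
have [d [u [d0 AE]]] := psd_decomposition pA.
have -> : \sum_i \sum_j a i * Num.conj (a j) * hadamard A B i j =
    \sum_r d r * \sum_i \sum_j (a i * u r i) * Num.conj (a j * u r j) * B i j.
  under [RHS]eq_bigr do rewrite mulr_sumr.
  rewrite [RHS]exchange_big /=; apply: eq_bigr => i _.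
  under [RHS]eq_bigr do rewrite mulr_sumr.
  rewrite [RHS]exchange_big /=; apply: eq_bigr => j _.
  rewrite mxE AE mulr_suml mulr_sumr; apply: eq_bigr => r _.
  by rewrite rmorphM /=; ring.
by apply: sumr_ge0 => r _; rewrite mulr_ge0.
Qed.

Lemma psdD k (A B : 'M[R[i]]_k) : psd A -> psd B -> psd (A + B).
Proof.
move=> [Ah Aq] [Bh Bq]; split=> [i j|a]; first by rewrite !mxE Ah Bh rmorphD.
rewrite (_ : \sum_i _ = \sum_i \sum_j a i * Num.conj (a j) * A i j +
  \sum_i \sum_j a i * Num.conj (a j) * B i j) ?addr_ge0 //.
rewrite -big_split; apply: eq_bigr => i _; rewrite -big_split.
by apply: eq_bigr => j _; rewrite mxE mulrDr.
Qed.

Lemma psdZ k (c : R) (A : 'M[R[i]]_k) : 0 <= c -> psd A -> psd (c%:C%C *: A).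
Proof.
move=> c0 [Ah Aq]; split=> [i j|a].
  by rewrite !mxE Ah rmorphM /=; congr (_ * _); rewrite conj_Creal // ger0_real // ler0c.
rewrite (_ : \sum_i _ = c%:C%C * \sum_i \sum_j a i * Num.conj (a j) * A i j).
  by rewrite mulr_ge0 // ler0c.
rewrite mulr_sumr; apply: eq_bigr => i _; rewrite mulr_sumr.
by apply: eq_bigr => j _; rewrite mxE; ring.
Qed.

(** Loewner-order bounds multiply under entrywise products, the two changes of
    factor being made one after the other. *)
Lemma psd_hadamard_le k (A A' B B' : 'M[R[i]]_k) (c d : R) : 0 <= d ->
  psd A' -> psd B -> psd (c%:C%C *: A - A') -> psd (d%:C%C *: B - B') ->
  psd ((c * d)%:C%C *: hadamard A B - hadamard A' B').
Proof.
move=> d0 pA' pB h1 h2.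
suff -> : (c * d)%:C%C *: hadamard A B - hadamard A' B' =
    hadamard (c%:C%C *: A - A') (d%:C%C *: B) + hadamard A' (d%:C%C *: B - B').
  by apply: psdD; apply: psd_hadamard => //; apply: psdZ.
by apply/matrixP => i j; rewrite !mxE rmorphM /=; ring.
Qed.

(** The matrix is the sum over the classes of the matrices of all ones on a
    class, each of which has rank one. *)
Lemma psd_per k (E : rel 'I_k) : symmetric E -> transitive E ->
  psd (\matrix_(i, j) (E i j)%:R).
Proof.
move=> Es Et; pose rep i : option 'I_k := [pick j | E i j].
have repP i j : E i j -> rep i = rep j.
  move=> Eij; rewrite /rep; apply: eq_pick => l; apply/idP/idP; apply: Et => //.
  by rewrite Es.
have EE i j : E i j = (rep i != None) && (rep i == rep j).
  apply/idP/andP => [Eij|[]].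
    split; last exact/eqP/repP.
    by rewrite /rep; case: pickP => // /(_ j); rewrite Eij.
  move=> + /eqP; rewrite /rep; case: pickP => // m Eim _.
  case: pickP => // n Ejn [mn]; apply: Et Eim _.
  by rewrite Es mn.
split=> [i j|a]; first by rewrite !mxE rmorph_nat Es.
have -> : \sum_i \sum_j a i * Num.conj (a j) * (\matrix_(i, j) (E i j)%:R) i j =
    \sum_r (\sum_(i | rep i == Some r) a i) * Num.conj (\sum_(i | rep i == Some r) a i).
  under [RHS]eq_bigr do rewrite rmorph_sum big_distrlr /= big_mkcond /=.
  rewrite [RHS]exchange_big /=; apply: eq_bigr => i _.
  case ri : (rep i) => [r|]; last first.
    rewrite big1 => [|j _]; last by rewrite mxE EE ri /= mulr0.
    by rewrite big1.
  rewrite [RHS](bigD1 r) //= eqxx [X in _ + X]big1 ?addr0; last first.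
    move=> r' /negPf r'r; rewrite (_ : (Some r == Some r') = false) //.
    by apply/eqP => -[rr']; rewrite rr' eqxx in r'r.
  rewrite [RHS]big_mkcond; apply: eq_bigr => j _; rewrite mxE EE ri /=.
  by rewrite eq_sym; case: ifP; rewrite ?mulr1 ?mulr0.
by apply: sumr_ge0 => r _; rewrite -normCK exprn_ge0.
Qed.

End SchurProduct.

(** * Extension of bounded operators from dense subspaces *)

Section BoundedExtension.
Context {R : realType} {V W : lmodType R[i]}.
Implicit Types (ipV : {dot V for Num.conj}) (ipW : {dot W for Num.conj}).
Implicit Types (S : V -> W -> Prop).

Definition linear_relation S : Prop :=
  forall (t : R[i]) x y x' y', S x y -> S x' y' -> S (t *: x + x') (t *: y + y').

(** The closure of the graph of a partially defined bounded operator. *)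
Definition graph_closure ipV ipW S (x : V) (y : W) : Prop :=
  forall e : R, 0 < e -> exists x' y',
    [/\ S x' y', hnorm ipV (x - x') < e & hnorm ipW (y - y') < e].

Lemma graph_closure_linear ipV ipW S :
  linear_relation S -> linear_relation (graph_closure ipV ipW S).
Proof.
move=> lS t x y x' y' h h' e e0.
pose d := e / (cmod t + 1).
have t1 : 0 < cmod t + 1 by rewrite ltr_wpDl // cmod_ge0.
have d0 : 0 < d by rewrite divr_gt0.
have [u [v [Suv hu hv]]] := h d d0.
have [u' [v' [Suv' hu' hv']]] := h' d d0.
exists (t *: u + u'), (t *: v + v'); split; first exact: lS.
- rewrite (_ : _ - _ = t *: (x - u) + (x' - u')); last first.
    by rewrite scalerBr opprD addrACA.
  apply: le_lt_trans (hnorm_triangle _ _ _) _; rewrite hnormZ.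
  have -> : e = cmod t * d + d by rewrite /d; field; exact: lt0r_neq0.
  by apply: ler_ltD => //; rewrite ler_wpM2l ?cmod_ge0 // ltW.
- rewrite (_ : _ - _ = t *: (y - v) + (y' - v')); last first.
    by rewrite scalerBr opprD addrACA.
  apply: le_lt_trans (hnorm_triangle _ _ _) _; rewrite hnormZ.
  have -> : e = cmod t * d + d by rewrite /d; field; exact: lt0r_neq0.
  by apply: ler_ltD => //; rewrite ler_wpM2l ?cmod_ge0 // ltW.
Qed.

Lemma graph_closure_le ipV ipW S (c : R) :
  (forall x y, S x y -> hnorm ipW y <= c * hnorm ipV x) -> 0 <= c ->
  forall x y, graph_closure ipV ipW S x y -> hnorm ipW y <= c * hnorm ipV x.
Proof.
move=> hS c0 x y h; apply/ler_addgt0Pr => e e0.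
have t1 : 0 < c + 1 by rewrite ltr_wpDl.
have [u [v [Suv hu hv]]] := h (e / (c + 1)) (divr_gt0 e0 t1).
apply: le_trans (hnorm_le_sub ipW y v) _.
have h1 := hS _ _ Suv.
have h2 : c * hnorm ipV u <= c * (hnorm ipV x + hnorm ipV (x - u)).
  by rewrite ler_wpM2l // hnormBC hnorm_le_sub.
have h3 : c * hnorm ipV (x - u) <= c * (e / (c + 1)) by rewrite ler_wpM2l // ltW.
have h4 : e = c * (e / (c + 1)) + e / (c + 1) by field; exact: lt0r_neq0.
by rewrite h4; move: h1 h2 h3 hv; lra.
Qed.

(** Points of the domain converging to [x] form a Cauchy sequence, hence so do
    their images, and the target is complete. *)
Lemma graph_closure_total ipV ipW S (c : R) : hilbert ipW -> linear_relation S ->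
  0 <= c -> (forall x y, S x y -> hnorm ipW y <= c * hnorm ipV x) ->
  hclosure ipV [set x | exists y, S x y] = setT ->
  forall x, exists y, graph_closure ipV ipW S x y.
Proof.
move=> hW lS c0 hS dense x.
have approx n : exists xy : V * W, S xy.1 xy.2 /\ hnorm ipV (x - xy.1) < n.+1%:R^-1.
  have : hclosure ipV [set x | exists y, S x y] x by rewrite dense.
  move=> /(_ n.+1%:R^-1) []; first by rewrite invr_gt0 ltr0n.
  by move=> x' [y' Sxy] hx; exists (x', y').
have [u hu] := choice approx.
have small (e : R) : 0 < e -> exists N, forall n, (N <= n)%N -> n.+1%:R^-1 < e.
  move=> e0; have [N _ hN] := near_infty_natSinv_lt (PosNum e0).
  by exists N => n /hN.
have [|y hy] := hW (fun n => (u n).2).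
  move=> e e0; have c1 : 0 < 2 * (c + 1) by rewrite mulr_gt0 // ltr_wpDl.
  have [N hN] := small (e / (2 * (c + 1))) (divr_gt0 e0 c1).
  exists N => m n Nm Nn.
  have SB : S ((u m).1 - (u n).1) ((u m).2 - (u n).2).
    have := lS (-1) _ _ _ _ (hu n).1 (hu m).1.
    by rewrite !scaleN1r ![- _ + _]addrC.
  apply: le_lt_trans (hS _ _ SB) _.
  have h1 : hnorm ipV ((u m).1 - (u n).1) <= e / (c + 1).
    rewrite (_ : _ - _ = (x - (u n).1) - (x - (u m).1)); last first.
      by rewrite opprB [RHS]addrC addrA subrK.
    apply: le_trans (hnorm_triangleB _ _ _) _.
    have := lt_trans (hu m).2 (hN m Nm); have := lt_trans (hu n).2 (hN n Nn).
    have -> : e / (2 * (c + 1)) = e / (c + 1) / 2.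
      by field; apply: lt0r_neq0; rewrite ltr_wpDl.
    by lra.
  apply: le_lt_trans (ler_wpM2l c0 h1) _.
  rewrite mulrCA mulrA ltr_pdivrMr ?ltr_wpDl // mulrC mulrDr mulr1.
  by rewrite [e * c]mulrC ltrDl.
exists y => e e0.
move/cvgrPdist_lt : hy => /(_ e e0)[N _ hN].
have [N' hN'] := small e e0.
exists (u (maxn N N')).1, (u (maxn N N')).2; split.
- exact: (hu _).1.
- by apply: lt_trans (hu _).2 (hN' _ _); exact: leq_maxr.
have := hN (maxn N N') (leq_maxl _ _).
by rewrite /= sub0r normrN ger0_norm ?hnorm_ge0 // hnormBC.
Qed.

End BoundedExtension.

(** The two bounds make the closure of the relation single-valued in both
    directions; density and completeness make it total in both directions. *)
Lemma bilipschitz_extension {R : realType} {V W : lmodType R[i]}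
    (ipV : {dot V for Num.conj}) (ipW : {dot W for Num.conj})
    (S : V -> W -> Prop) (c : R) :
  hilbert ipV -> hilbert ipW -> linear_relation S -> 0 <= c ->
  (forall x y, S x y -> hnorm ipV x <= hnorm ipW y <= c * hnorm ipV x) ->
  hclosure ipV [set x | exists y, S x y] = setT ->
  hclosure ipW [set y | exists x, S x y] = setT ->
  exists Phi : {linear V -> W}, [/\ forall x y, S x y -> Phi x = y, bijective Phi &
    forall x, hnorm ipV x <= hnorm ipW (Phi x) <= c * hnorm ipV x].
Proof.
move=> hV hW lS c0 hS denseV denseW.
pose G := graph_closure ipV ipW S.
have lG : linear_relation G by exact: graph_closure_linear.
have Gup x y : G x y -> hnorm ipW y <= c * hnorm ipV x.
  by apply: graph_closure_le => // ? ? /hS/andP[].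
have flip x y : graph_closure ipW ipV (fun y x => S x y) y x <-> G x y.
  by split=> h e /h[u [v [? ? ?]]]; exists v, u.
have Glow x y : G x y -> hnorm ipV x <= hnorm ipW y.
  move=> /flip h; rewrite -[leRHS]mul1r; apply: graph_closure_le h => // u v.
  by move=> /hS/andP[]; rewrite mul1r.
have totV : forall x, exists y, G x y.
  by apply: (@graph_closure_total _ _ _ ipV ipW S c) => // x y /hS/andP[].
(* Surjectivity is totality of the inverse relation, which is bounded too. *)
have totW y : exists x, G x y.
  have [| | |x /flip Gxy] := @graph_closure_total _ _ _ ipW ipV (fun y x => S x y) 1 hV _ ler01 _ _ y.
  - by move=> t x1 y1 x2 y2; exact: lS.
  - by move=> u v /hS/andP[]; rewrite mul1r.
  - by [].
  - by exists x.
have Gfun x y y' : G x y -> G x y' -> y = y'.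
  move=> h h'; apply/eqP; rewrite -subr_eq0 -(hnorm_eq0 ipW) eq_le hnorm_ge0 andbT.
  have := Gup _ _ (lG (-1) _ _ _ _ h' h).
  by rewrite !scaleN1r addNr hnorm0 mulr0 addrC.
have Ginj x x' y : G x y -> G x' y -> x = x'.
  move=> h h'; apply/eqP; rewrite -subr_eq0 -(hnorm_eq0 ipV) eq_le hnorm_ge0 andbT.
  have := Glow _ _ (lG (-1) _ _ _ _ h' h).
  by rewrite !scaleN1r addNr hnorm0 addrC.
have [phi phiP] := choice totV; have [psi psiP] := choice totW.
have phi_lin : linear phi.
  by move=> t u v; apply: Gfun (phiP _) (lG _ _ _ _ _ (phiP u) (phiP v)).
pose Phi : {linear V -> W} := HB.pack phi (GRing.isLinear.Build _ _ _ _ phi phi_lin).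
exists Phi; split.
- move=> x y Sxy; apply: Gfun (phiP x) _ => e e0.
  by exists x, y; rewrite !subrr !hnorm0.
- exists psi => [x|y]; first exact: Ginj (psiP _) (phiP _).
  exact: Gfun (phiP _) (psiP _).
- by move=> x; rewrite Glow ?Gup //; exact: phiP.
Qed.

Lemma image_closed_span {R : realType} {V W : lmodType R[i]}
    (ipV : {dot V for Num.conj}) (ipW : {dot W for Num.conj})
    (Phi : {linear V -> W}) (c : R) (A : set V) :
  bijective Phi ->
  (forall x, hnorm ipV x <= hnorm ipW (Phi x) <= c * hnorm ipV x) -> 0 < c ->
  Phi @` hclosure ipV (lspan A) = hclosure ipW (lspan (Phi @` A)).
Proof.
move=> [Psi PhiK PsiK] hb c0; apply/seteqP; split=> [_ [x clx <-] e e0|y cly].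
  have [w [k [a [v [Av ->]]]] hw] := clx (e / c) (divr_gt0 e0 c0).
  exists (\sum_i a i *: Phi (v i)).
    by exists k, a, (Phi \o v); split=> // i; exists (v i).
  rewrite (_ : \sum_i _ = Phi (\sum_i a i *: v i)); last first.
    by rewrite linear_sum; apply: eq_bigr => i _; rewrite linearZ.
  rewrite -raddfB; have /andP[_ h] := hb (x - \sum_i a i *: v i).
  by apply: le_lt_trans h _; rewrite mulrC -ltr_pdivlMr.
exists (Psi y); last exact: PsiK.
move=> e e0; have [w [k [a [v [Av ->]]]] hw] := cly e e0.
have pre i : exists x, A x /\ Phi x = v i by have [x ? <-] := Av i; exists x.
have [v' hv'] := choice pre.
exists (\sum_i a i *: v' i); first by exists k, a, v'; split=> // i; exact: (hv' i).1.
have /andP[h _] := hb (Psi y - \sum_i a i *: v' i).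
apply: le_lt_trans h _; rewrite linearB linear_sum /= PsiK.
rewrite (eq_bigr (fun i => a i *: v i)) // => i _.
by rewrite linearZ (hv' i).2.
Qed.

(** * C-sequences, C0-sequences and infinite Gram matrices *)

Section SequencesOfVectors.
Context {R : realType} {H : nat -> lmodType R[i]}.
Implicit Types (ip : forall n, {dot H n for Num.conj}) (h f g y : forall n, H n).

Lemma C0seqsP ip h :
  C0seqs ip h <-> bounded_sums (fun n => `|1 - hnorm (ip n) (h n)|).
Proof. by apply: bounded_sumsP => n; exact: normr_ge0. Qed.

Lemma C0_classP ip y h : C0_class ip y h <->
  C0seqs ip h /\ bounded_sums (fun n => cmod (1 - ip n (h n) (y n))).
Proof.
rewrite /C0_class /=; split=> -[h0 hs]; split=> //.
  by apply/(bounded_sumsP (fun n => cmod_ge0 _)).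
by apply/(@bounded_sumsP _ (fun n => cmod _) (fun n => cmod_ge0 _)).
Qed.

Lemma bounded_sums_sup (u : nat -> R) : (forall n, 0 <= u n) ->
  bounded_sums u -> exists2 B, 0 <= B & forall n, u n <= B.
Proof.
move=> u0 [B hB]; exists B => [|n]; first by have := hB 0%N; rewrite big_nil.
by apply: le_trans (hB n.+1); rewrite big_nat_recr //= lerDr sumr_ge0.
Qed.

Lemma C0seqs_norm_bounded ip h : C0seqs ip h ->
  exists2 K, 0 <= K & forall n, hnorm (ip n) (h n) <= K.
Proof.
move=> /C0seqsP/bounded_sums_sup[|B B0 hB]; first by move=> n; exact: normr_ge0.
exists (B + 1) => [|n]; first by rewrite addr_ge0.
have := hB n; rewrite distrC => hn.
by have := ler_norm (hnorm (ip n) (h n) - 1); lra.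
Qed.

Lemma C0seqs_sqr ip h : C0seqs ip h ->
  bounded_sums (fun n => `|1 - hnorm (ip n) (h n) ^+ 2|).
Proof.
move=> h0; have [K K0 hK] := C0seqs_norm_bounded h0.
have /C0seqsP sh := h0.
apply: bounded_sums_le (bounded_sumsZ (addr_ge0 ler01 K0) sh) => n.
set x := hnorm _ _; have x0 : 0 <= x by exact: hnorm_ge0.
have -> : 1 - x ^+ 2 = (1 + x) * (1 - x) by ring.
rewrite normrM ler_wpM2r // ger0_norm ?addr_ge0 // lerD2l; exact: hK.
Qed.

Lemma C0seqs_Cseqs ip h : C0seqs ip h -> Cseqs ip h.
Proof.
move=> /C0seqsP sh.
have [|a ha] := @summable_uncond_prod R (fun n => (hnorm (ip n) (h n))%:C%C).
  apply: bounded_sums_le sh => n.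
  by rewrite -(rmorph1 (real_complex R)) -rmorphB cmod_real.
exists (cmod a); have := uncond_prod_cmod ha.
by under eq_fun do rewrite cmod_real ger0_norm ?hnorm_ge0 //.
Qed.

(** A C-sequence that is not a C0-sequence has norm product 0, hence a zero
    elementary tensor. *)
Lemma uncond_prod_C0seqs ip h a : a != 0 ->
  uncond_prod (fun n => hnorm (ip n) (h n)) a -> C0seqs ip h.
Proof.
move=> a0 /uncond_prod_real/uncond_prod_summable sh; apply/C0seqsP.
have {}sh := sh ltac:(by rewrite (inj_eq (@complexI R) a 0)).
apply: bounded_sums_le sh => n.
by rewrite -(rmorph1 (real_complex R)) -rmorphB cmod_real.
Qed.

Lemma uncond_prod_hnorm_ge0 ip h a :
  uncond_prod (fun n => hnorm (ip n) (h n)) a -> 0 <= a.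
Proof.
move=> /uncond_prod_cvg ha; rewrite -(cvg_lim (@Rhausdorff R) ha).
apply: limr_ge; first by apply/cvg_ex; exists a.
by apply: nearW => N; apply: prodr_ge0 => n _; exact: hnorm_ge0.
Qed.

(** A tail over which the sum is below 1/4 has products at least 1/2. *)
Lemma uncond_prod_gt0 (x : nat -> R) a : (forall n, 0 < x n) ->
  bounded_sums (fun n => `|1 - x n|) -> uncond_prod x a -> 0 < a.
Proof.
move=> x0 sx /uncond_prod_cvg xa.
have e0 : 0 < 4^-1 :> R by rewrite invr_gt0.
have [n0 hn0] := sum_tail_small (fun n => normr_ge0 (1 - x n)) sx e0.
have P0 : 0 < \prod_(0 <= n < n0) x n by exact: prodr_gt0.
have P2 : 0 < (\prod_(0 <= n < n0) x n) / 2 by rewrite divr_gt0.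
apply: lt_le_trans P2 _; apply: ler_cvg_to (cvg_cst _) xa _.
exists n0 => // N /= n0N; rewrite [leRHS](big_cat_nat (n := n0)) //= ler_pM2l //.
have cE n : cmod (1 - (x n)%:C%C) = `|1 - x n|.
  by rewrite -(rmorph1 (real_complex R)) -rmorphB cmod_real.
have tail : \sum_(n <- index_iota n0 N) cmod (1 - (x n)%:C%C) < 4^-1.
  under eq_bigr do rewrite cE.
  apply: hn0; first exact: iota_uniq.
  by move=> i; rewrite mem_index_iota => /andP[].
have := @prod_sub1_le R (fun n => (x n)%:C%C) (index_iota n0 N).
rewrite -rmorph_prod -[X in cmod (_ - X)](rmorph1 (real_complex R)) -rmorphB cmod_real.
move: tail; move: (\sum_(_ <- _) _) (\prod_(_ <= _ < _) _) => S P.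
move=> tail h; have {}h := h ltac:(lra).
have := ler_norm (- (P - 1)); rewrite normrN; lra.
Qed.

Lemma uncond_prod_dot_self ip h a :
  uncond_prod (fun n => hnorm (ip n) (h n)) a ->
  uncond_prod (fun n => ip n (h n) (h n)) (a ^+ 2)%:C%C.
Proof.
move=> ha; have := uncond_prod_real (uncond_prodM ha ha).
by under eq_fun do rewrite -expr2 -dot_hnorm.
Qed.

(** The equivalence of C0-sequences, as a partial equivalence relation on all
    sequences of vectors. *)
Definition gram_rel ip h f : Prop := [/\ C0seqs ip h, C0seqs ip f &
  bounded_sums (fun n => cmod (1 - ip n (h n) (f n)))].

Lemma cmod_1dotC ip h f n :
  cmod (1 - ip n (h n) (f n)) = cmod (1 - ip n (f n) (h n)).
Proof. by rewrite (dotC (ip n)) -(rmorph1 Num.conj) -rmorphB cmod_conj rmorph1. Qed.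

Lemma gram_rel_sym ip h f : gram_rel ip h f -> gram_rel ip f h.
Proof. by move=> [h0 f0 hf]; split=> //; under eq_fun do rewrite cmod_1dotC. Qed.

(** Equivalent sequences differ by a square-summable sequence, and
    [<h, g> = <h, f> + <f, g> - <f, f> - <h - f, f - g>]. *)
Lemma gram_rel_trans ip f h g : gram_rel ip h f -> gram_rel ip f g -> gram_rel ip h g.
Proof.
have sqr_dist h1 h2 : gram_rel ip h1 h2 ->
    bounded_sums (fun n => hnorm (ip n) (h1 n - h2 n) ^+ 2).
  move=> [/C0seqs_sqr s1 /C0seqs_sqr s2 s12].
  apply: bounded_sums_le (bounded_sumsD (bounded_sumsD s1 s2)
    (bounded_sumsZ (ler0n R 2) s12)) => n.
  have := hnorm_lin_sqr (ip n) (h1 n) (h2 n) (-1).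
  rewrite scaleN1r => ->; rewrite cmodN cmod1 expr1n mul1r mulN1r raddfN /=.
  have := ler_norm (- (1 - hnorm (ip n) (h1 n) ^+ 2)).
  have := ler_norm (- (1 - hnorm (ip n) (h2 n) ^+ 2)).
  have := le_trans (ler_norm _) (Re_le_cmod (1 - ip n (h1 n) (h2 n))).
  rewrite cmod_1dotC raddfB /= !normrN.
  have -> : complex.Re (ip n (h1 n) (h2 n)) = complex.Re (ip n (h2 n) (h1 n)).
    by rewrite dotC; case: (ip n _ _).
  by lra.
move=> hf fg; have s1 := sqr_dist _ _ hf; have s2 := sqr_dist _ _ fg.
case: hf fg => h0 f0 hf [_ g0 fg]; split=> //.
apply: bounded_sums_le (bounded_sumsD (bounded_sumsD hf fg)
  (bounded_sumsD (C0seqs_sqr f0) (bounded_sumsD s1 s2))) => n.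
have -> : 1 - ip n (h n) (g n) = (1 - ip n (h n) (f n)) + (1 - ip n (f n) (g n)) +
    (- (1 - hnorm (ip n) (f n) ^+ 2)%:C%C + ip n (h n - f n) (f n - g n)).
  have -> : (1 - hnorm (ip n) (f n) ^+ 2)%:C%C = 1 - ip n (f n) (f n).
    by rewrite dot_hnorm rmorphB rmorph1.
  rewrite dotBl !dotBr; ring.
apply: le_trans (cmodD _ _) _; apply: lerD; first exact: cmodD.
apply: le_trans (cmodD _ _) _; rewrite cmodN cmod_real lerD2l.
apply: le_trans (dot_cauchy_schwarz _ _ _) _.
move: (hnorm _ _) (hnorm _ _) => x y.
have := sqr_ge0 (x - y); have := sqr_ge0 x; have := sqr_ge0 y.
by rewrite sqrrB mulr2n; lra.
Qed.

(** Across distinct classes the quasi-convergent product has value 0 whether or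
    not the partial products converge, so the Gram matrix of elementary tensors
    is a limit of finite products only after masking by [gram_rel]. *)
Lemma gram_limit ip h f : Cseqs ip h -> Cseqs ip f ->
  (`[< gram_rel ip h f >]%:R * \prod_(0 <= n < N) ip n (h n) (f n) :
     (R[i] : numFieldType)) @[N --> \oo] -->
  (qprod (fun n => ip n (h n) (f n)) : (R[i] : numFieldType)).
Proof.
move=> [a ha] [b hb]; case: asboolP => hf.
  case: hf => _ _ /summable_uncond_prod[z hz].
  rewrite (qprodE hz); under eq_fun do rewrite mul1r.
  exact: uncond_prod_cvg hz.
rewrite (_ : qprod _ = 0); first by under eq_fun do rewrite mul0r; exact: cvg_cst.
apply/eqP; apply: contrapT => /negP q0; apply: hf.
have hq := qprod_neq0 q0.
have qab : cmod (qprod (fun n => ip n (h n) (f n))) <= a * b.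
  have cq := uncond_prod_cvg (uncond_prod_cmod hq).
  have cab := uncond_prod_cvg (uncond_prodM ha hb).
  apply: ler_cvg_to cq cab _; apply: nearW => N.
  apply: ler_prod => n _; rewrite cmod_ge0; exact: dot_cauchy_schwarz.
have {}qab : 0 < a * b by apply: lt_le_trans qab; rewrite lt_def cmod_ge0 cmod_eq0 q0.
have a0 : a != 0 by apply: contraTneq qab => ->; rewrite mul0r ltxx.
have b0 : b != 0 by apply: contraTneq qab => ->; rewrite mulr0 ltxx.
split; [exact: uncond_prod_C0seqs ha|exact: uncond_prod_C0seqs hb|].
exact: uncond_prod_summable q0 hq.
Qed.

End SequencesOfVectors.

(** * Extremal vectors of an optimal pair of norm bounds *)

Section NormConstants.
Context {R : realType} {V : lmodType R[i]}.
Implicit Types (A : set V) (p q : V -> R).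

Lemma norm_bounds_gt0 A p q M N h : A h -> 0 < p h -> 0 < q h ->
  norm_bounds A p q M N -> 0 < M /\ 0 < N.
Proof.
move=> Ah p0 q0 [/(_ h Ah) hM /(_ h Ah) hN]; split.
  by have := lt_le_trans p0 hM; rewrite pmulr_lgt0.
by have := lt_le_trans q0 hN; rewrite pmulr_lgt0.
Qed.

Lemma hconst_le A p q M N h : A h -> 0 < p h -> 0 < q h ->
  norm_bounds A p q M N -> hconst A p q <= M * N.
Proof.
move=> Ah p0 q0 b; apply: ge_inf; last by exists M, N.
exists 0 => _ [M' [N' [b' ->]]].
have [? ?] := norm_bounds_gt0 Ah p0 q0 b'.
by rewrite mulr_ge0 // ltW.
Qed.

Lemma hconst_eq A p q c : norm_bounds A p q 1 c ->
  (forall M N, norm_bounds A p q M N -> c <= M * N) -> hconst A p q = c.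
Proof.
move=> b h.
have inS : [set c | exists M N : R, norm_bounds A p q M N /\ c = M * N] c.
  by exists 1, c; rewrite mul1r.
apply/eqP; rewrite eq_le; apply/andP; split.
  by apply: ge_inf => //; exists c => _ [M [N [/h ? ->]]].
apply: lb_le_inf; first by exists c.
by move=> _ [M [N [/h ? ->]]].
Qed.

End NormConstants.

Section ExtremalVectors.
Context {R : realType} {V : lmodType R[i]}.
Variables ip ipt : {dot V for Num.conj}.
Let p := hnorm ip.
Let q := hnorm ipt.
Let c := hconst setT p q.
Hypothesis V_nontrivial : exists h : V, h != 0.
Hypothesis pq : forall h, p h <= q h /\ q h <= c * p h.

Lemma hconst_optimal M N : norm_bounds setT p q M N -> c <= M * N.
Proof.
have [h h0] := V_nontrivial.
have p0 : 0 < p h by rewrite hnorm_gt0.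
by apply: (@hconst_le _ _ _ _ _ _ _ h) => //; exact: lt_le_trans p0 (pq h).1.
Qed.

Lemma hconst_ge1 : 1 <= c.
Proof.
have [h h0] := V_nontrivial.
have p0 : 0 < p h by rewrite hnorm_gt0.
have [h1 h2] := pq h.
by have := le_trans h1 h2; rewrite -{1}[p h]mul1r ler_pM2r.
Qed.

Lemma normalize h : h != 0 ->
  exists h', p h' = 1 /\ q h' = q h / p h.
Proof.
move=> h0; have p0 : 0 < p h by rewrite hnorm_gt0.
exists ((p h)^-1%:C%C *: h); rewrite /p /q !hnormZ cmod_real ger0_norm; last first.
  by rewrite invr_ge0 ltW.
by rewrite mulVf ?gt_eqF // mulrC.
Qed.

(** Otherwise [q <= t * c * p], and the constants 1 and [t * c] beat the infimum
    [c]. *)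
Lemma almost_maximal t : 0 < t < 1 -> exists h, p h = 1 /\ t * c <= q h.
Proof.
move=> /andP[t0 t1]; apply: contrapT => /forallNP none.
have c0 : 0 < c := lt_le_trans ltr01 hconst_ge1.
have : c <= 1 * (t * c).
  apply: hconst_optimal; split=> h _; first by rewrite mul1r; exact: (pq h).1.
  have [->|h0] := eqVneq h 0; first by rewrite /p /q !hnorm0 mulr0.
  have [h' [ph' qh']] := normalize h0.
  have p0 : 0 < p h by rewrite hnorm_gt0.
  rewrite -ler_pdivrMr // -qh' leNgt; apply/negP => /ltW lt.
  by apply: (none h').
by rewrite mul1r leNgt -subr_gt0 -{1}[c]mul1r -mulrBl mulr_gt0 // subr_gt0.
Qed.

(** Otherwise [p <= t * q], and the constants [t] and [c] beat the infimum [c]. *)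
Lemma almost_minimal t : 0 < t < 1 -> exists h, p h = 1 /\ t * q h <= 1.
Proof.
move=> /andP[t0 t1]; apply: contrapT => /forallNP none.
have c0 : 0 < c := lt_le_trans ltr01 hconst_ge1.
have : c <= t * c.
  apply: hconst_optimal; split=> h _; last exact: (pq h).2.
  have [->|h0] := eqVneq h 0; first by rewrite /p /q !hnorm0 mulr0.
  have [h' [ph' qh']] := normalize h0.
  have p0 : 0 < p h by rewrite hnorm_gt0.
  rewrite -[leLHS]mul1r -ler_pdivlMr // -mulrA -qh' leNgt; apply/negP => /ltW lt.
  by apply: (none h').
by rewrite leNgt -subr_gt0 -{1}[c]mul1r -mulrBl mulr_gt0 // subr_gt0.
Qed.

End ExtremalVectors.

Lemma bernoulli_le {R : realType} (t : R) n : 0 <= t <= 1 -> 1 - n%:R * (1 - t) <= t ^+ n.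
Proof.
move=> /andP[t0 t1]; elim: n => [|n IH]; first by rewrite mul0r subr0 expr0.
rewrite exprS -natr1 mulrDl mul1r.
have := ler_wpM2l t0 IH.
have : 0 <= n%:R * (1 - t) * (1 - t) by rewrite !mulr_ge0 // subr_ge0.
by move: (n%:R) => m; nra.
Qed.

(** Lets the relative error of [n] nearly extremal vectors vanish. *)
Lemma le_of_expr_le {R : realType} (x y : R) n : 0 <= x ->
  (forall t, 0 < t < 1 -> t ^+ n * x <= y) -> x <= y.
Proof.
move=> x0 h; apply/ler_addgt0Pr => e e0.
have D0 : 0 < n%:R * x + e + 1 by rewrite ltr_wpDl // addr_ge0 ?mulr_ge0 // ltW.
set d := e / (n%:R * x + e + 1).
have d0 : 0 < d by rewrite divr_gt0.
have nx0 : 0 <= n%:R * x by rewrite mulr_ge0.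
have d1 : d < 1 by rewrite ltr_pdivrMr // mul1r; lra.
have ht : 0 < 1 - d < 1 by apply/andP; split; lra.
have ht' : 0 <= 1 - d <= 1 by apply/andP; split; lra.
have := h _ ht; have := ler_wpM2r x0 (bernoulli_le n ht').
have : n%:R * x * d <= e.
  rewrite mulrA ler_pdivrMr // mulrC ler_pM2l //; lra.
have -> : (1 - n%:R * (1 - (1 - d))) * x = x - n%:R * x * d by ring.
by lra.
Qed.

(** * Comparison of two sequences of norms *)

Section Comparison.
Context {R : realType} {H : nat -> lmodType R[i]}.
Variables ip ipt : forall n, {dot H n for Num.conj}.
Variables (c : nat -> R) (K : R).
Hypothesis pq : forall n (h : H n),
  hnorm (ip n) h <= hnorm (ipt n) h /\ hnorm (ipt n) h <= c n * hnorm (ip n) h.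
Hypothesis c_ge1 : forall n, 1 <= c n.
Hypothesis c_prod : uncond_prod c K.
Hypothesis c_le : forall N, \prod_(0 <= n < N) c n <= K.
Implicit Types (h f y : forall n, H n).

Lemma K_ge1 : 1 <= K.
Proof. by have := c_le 0; rewrite big_nil. Qed.

Lemma sqr_sub1_summable : bounded_sums (fun n => c n ^+ 2 - 1).
Proof.
have KK : (K * K)%:C%C != 0 :> R[i].
  rewrite (inj_eq (@complexI R) _ 0) mulf_neq0 // gt_eqF //; exact: lt_le_trans K_ge1.
have := uncond_prod_summable KK (uncond_prod_real (uncond_prodM c_prod c_prod)).
apply: bounded_sums_le => n.
rewrite -(rmorph1 (real_complex R)) -rmorphB cmod_real distrC -expr2.
exact: ler_norm.
Qed.

Lemma C0seqs_compare : C0seqs ipt = C0seqs ip.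
Proof.
have gap n (h : H n) : hnorm (ipt n) h - hnorm (ip n) h <= (c n ^+ 2 - 1) * hnorm (ip n) h.
  have [h1 h2] := pq h; have h3 := c_ge1 n; have h4 := hnorm_ge0 (ip n) h.
  have : c n * hnorm (ip n) h <= c n ^+ 2 * hnorm (ip n) h.
    by rewrite ler_wpM2r // expr2 ler_peMr // (le_trans ler01).
  by rewrite mulrBl mul1r; lra.
apply/seteqP; split=> h h0; have [B B0 hB] := C0seqs_norm_bounded h0;
    move/C0seqsP : h0 => h0; apply/C0seqsP;
    apply: bounded_sums_le (bounded_sumsD h0 (bounded_sumsZ B0 sqr_sub1_summable)) => n;
    have [h1 h2] := pq (h n); have h3 := gap n (h n); have h4 := hB n;
    have c2 : 0 <= c n ^+ 2 - 1 by rewrite subr_ge0 exprn_ege1.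
  have h5 : (c n ^+ 2 - 1) * hnorm (ip n) (h n) <= (c n ^+ 2 - 1) * B.
    by rewrite ler_wpM2l // (le_trans h1).
  rewrite [B * _]mulrC.
  rewrite -[1 - hnorm (ip n) (h n)](subrKA (hnorm (ipt n) (h n))).
  apply: le_trans (ler_normD _ _) _; rewrite lerD2l ger0_norm ?subr_ge0 //; lra.
have h5 : (c n ^+ 2 - 1) * hnorm (ip n) (h n) <= (c n ^+ 2 - 1) * B.
  by rewrite ler_wpM2l.
rewrite [B * _]mulrC.
rewrite -[1 - hnorm (ipt n) (h n)](subrKA (hnorm (ip n) (h n))).
apply: le_trans (ler_normD _ _) _; rewrite lerD2l distrC ger0_norm ?subr_ge0 //; lra.
Qed.

(** The inner products differ by at most [c n ^+ 2 - 1] times the norms, which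
    are bounded along C0-sequences. *)
Lemma dot_summable_compare h f : C0seqs ip h -> C0seqs ip f ->
  bounded_sums (fun n => cmod (1 - ipt n (h n) (f n))) <->
  bounded_sums (fun n => cmod (1 - ip n (h n) (f n))).
Proof.
move=> /C0seqs_norm_bounded[A A0 hA] /C0seqs_norm_bounded[B B0 hB].
have gap n : cmod (ipt n (h n) (f n) - ip n (h n) (f n)) <= A * B * (c n ^+ 2 - 1).
  apply: le_trans (dot_diff_le (@pq n) _ _) _; rewrite mulrC.
  by rewrite ler_wpM2r ?subr_ge0 ?exprn_ege1 // ler_pM // hnorm_ge0.
have AB := bounded_sumsZ (mulr_ge0 A0 B0) sqr_sub1_summable.
split=> s; apply: bounded_sums_le (bounded_sumsD s AB) => n.
  rewrite -[1 - ip n _ _](subrKA (ipt n (h n) (f n))).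
  by apply: le_trans (cmodD _ _) _; rewrite lerD2l.
rewrite -[1 - ipt n _ _](subrKA (ip n (h n) (f n))).
by apply: le_trans (cmodD _ _) _; rewrite lerD2l cmodBC.
Qed.

Lemma C0_class_compare y : C0seqs ip y -> C0_class ipt y = C0_class ip y.
Proof.
move=> y0; apply/seteqP; split=> h /C0_classP[h0 hs]; apply/C0_classP.
  by rewrite C0seqs_compare in h0; split=> //; apply/dot_summable_compare.
by rewrite C0seqs_compare; split=> //; apply/dot_summable_compare.
Qed.

Lemma gram_rel_compare h f : gram_rel ipt h f <-> gram_rel ip h f.
Proof.
rewrite /gram_rel C0seqs_compare.
by split=> -[h0 f0 hf]; split=> //; exact/dot_summable_compare.
Qed.

Lemma ratio_bounds n (h : H n) : h != 0 ->
  1 <= hnorm (ipt n) h / hnorm (ip n) h <= c n.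
Proof.
move=> h0; have p0 : 0 < hnorm (ip n) h by rewrite hnorm_gt0.
by rewrite ler_pdivlMr // mul1r ler_pdivrMr //; apply/andP; exact: pq.
Qed.

Lemma uncond_prod_ratio h : (forall n, h n != 0) -> exists r,
  [/\ uncond_prod (fun n => hnorm (ipt n) (h n) / hnorm (ip n) (h n)) r, 1 <= r &
    forall N, \prod_(0 <= n < N) (hnorm (ipt n) (h n) / hnorm (ip n) (h n)) <= r].
Proof.
move=> h0; have rb n := ratio_bounds (h0 n).
have [n|N|r [hr lr]] := @uncond_prod_ge1 _
    (fun n => hnorm (ipt n) (h n) / hnorm (ip n) (h n)) K.
- by have /andP[] := rb n.
- apply: le_trans (c_le N); apply: ler_prod => n _.
  by have /andP[h1 ->] := rb n; rewrite (le_trans ler01).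
by exists r; split=> //; have := lr 0; rewrite big_nil.
Qed.

(** A sequence with a zero entry has product 0 in both norms.  Otherwise the
    products of the norms differ by the nonzero product of the ratios. *)
Lemma Cseqs_compare : Cseqs ipt = Cseqs ip.
Proof.
apply/seteqP; split=> h [a ha]; have [[n hn]|hN0] := pselect (exists n, h n = 0).
- by exists 0; apply: (@uncond_prod_zero _ _ n); rewrite hn hnorm0.
- have h0 n : h n != 0 by apply/eqP => hn; apply: hN0; exists n.
  have [r [hr r1 _]] := uncond_prod_ratio h0.
  have rN0 : r != 0 by rewrite gt_eqF // (lt_le_trans ltr01).
  exists (a * r^-1); have := uncond_prodM ha (uncond_prodV rN0 hr).
  under eq_fun do rewrite invf_div mulrC divfK ?hnorm_eq0 //.
  by [].
- by exists 0; apply: (@uncond_prod_zero _ _ n); rewrite hn hnorm0.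
- have h0 n : h n != 0 by apply/eqP => hn; apply: hN0; exists n.
  have [r [hr _ _]] := uncond_prod_ratio h0.
  exists (a * r); have := uncond_prodM ha hr.
  by under eq_fun do rewrite mulrC divfK ?hnorm_eq0 //.
Qed.

End Comparison.

(** * Gram matrices of elementary tensors *)

Section GramMatrices.
Context {R : realType} {H : nat -> lmodType R[i]}.
Implicit Types (ip : forall n, {dot H n for Num.conj}).
Variables (k : nat) (h : 'I_k -> forall n, H n) (E : rel 'I_k).
Hypotheses (E_sym : symmetric E) (E_trans : transitive E).

Definition gram_mx ip n : 'M[R[i]]_k := \matrix_(i, j) ip n (h i n) (h j n).

Definition partial_gram ip N : 'M[R[i]]_k :=
  \matrix_(i, j) ((E i j)%:R * \prod_(0 <= n < N) ip n (h i n) (h j n)).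

Lemma partial_gramS ip N :
  partial_gram ip N.+1 = hadamard (partial_gram ip N) (gram_mx ip N).
Proof. by apply/matrixP => i j; rewrite !mxE big_nat_recr //= mulrA. Qed.

Lemma partial_gram0 ip : partial_gram ip 0 = \matrix_(i, j) (E i j)%:R.
Proof. by apply/matrixP => i j; rewrite !mxE big_nil mulr1. Qed.

Lemma psd_gram_mx ip n : psd (gram_mx ip n).
Proof.
split=> [i j|a]; first by rewrite !mxE dotC.
under eq_bigr do under eq_bigr do rewrite mxE.
by rewrite -dot_sum dnorm_ge0.
Qed.

Lemma psd_partial_gram ip N : psd (partial_gram ip N).
Proof.
elim: N => [|N IH]; first by rewrite partial_gram0; exact: psd_per.
by rewrite partial_gramS; apply: psd_hadamard => //; exact: psd_gram_mx.
Qed.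

(** The quadratic form at [a] is the difference of squared norms of the vector
    with coefficients [a]. *)
Lemma psd_gram_mx_le ip1 ip2 n (d : R) : 0 <= d ->
  (forall x, hnorm (ip1 n) x <= d * hnorm (ip2 n) x) ->
  psd ((d ^+ 2)%:C%C *: gram_mx ip2 n - gram_mx ip1 n).
Proof.
move=> d0 hd; split=> [i j|a].
  rewrite !mxE (dotC (ip2 n)) (dotC (ip1 n)) rmorphB [in RHS]rmorphM /=; congr (_ * _ - _).
  by rewrite conj_Creal // ger0_real // ler0c sqr_ge0.
rewrite (_ : \sum_i _ = (d ^+ 2)%:C%C * ip2 n (\sum_i a i *: h i n) (\sum_i a i *: h i n)
    - ip1 n (\sum_i a i *: h i n) (\sum_i a i *: h i n)).
  rewrite !dot_hnorm -rmorphM -rmorphB ler0c subr_ge0 -exprMn.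
  by rewrite ler_pXn2r ?nnegrE ?mulr_ge0 ?hnorm_ge0.
rewrite !dot_sum mulr_sumr -sumrB; apply: eq_bigr => i _.
rewrite mulr_sumr -sumrB; apply: eq_bigr => j _; rewrite !mxE; ring.
Qed.

Lemma psd_partial_gram_le ip1 ip2 (d : nat -> R) N : (forall n, 0 <= d n) ->
  (forall n x, hnorm (ip1 n) x <= d n * hnorm (ip2 n) x) ->
  psd ((\prod_(0 <= n < N) d n ^+ 2)%:C%C *: partial_gram ip2 N - partial_gram ip1 N).
Proof.
move=> d0 hd; elim: N => [|N IH].
  rewrite big_nil !partial_gram0 rmorph1 scale1r subrr -(scale0r (partial_gram ip1 0)).
  by rewrite -(rmorph0 (real_complex R)); apply: psdZ => //; exact: psd_partial_gram.
rewrite big_nat_recr //= !partial_gramS; apply: psd_hadamard_le => //.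
- exact: sqr_ge0.
- exact: psd_partial_gram.
- exact: psd_gram_mx.
- exact: psd_gram_mx_le.
Qed.

End GramMatrices.

Lemma cvg_finite_sum {K : numFieldType} k (F : 'I_k -> nat -> K) (a : 'I_k -> K) :
  (forall i, F i n @[n --> \oo] --> a i) ->
  \sum_i F i n @[n --> \oo] --> \sum_i a i.
Proof. by move=> h; apply: cvg_big => //; exact: add_continuous. Qed.

Section GramInequality.
Context {R : realType} {H : nat -> lmodType R[i]}.
Implicit Types (ip : forall n, {dot H n for Num.conj}).

(** The inequality between norms in each factor passes to finite entrywise
    products of Gram matrices masked by the equivalence relation, and to their
    limits by [gram_limit]. *)
Lemma tensor_gram_le ip1 ip2 (d : nat -> R) (D : R) k (h : 'I_k -> forall n, H n)
    (a : 'I_k -> R[i]) :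
  (forall n, 0 <= d n) -> (forall N, \prod_(0 <= n < N) d n <= D) ->
  (forall n x, hnorm (ip1 n) x <= d n * hnorm (ip2 n) x) ->
  (forall i, Cseqs ip1 (h i)) -> (forall i, Cseqs ip2 (h i)) ->
  (forall f g, gram_rel ip1 f g <-> gram_rel ip2 f g) ->
  complex.Re (\sum_i \sum_j a i * Num.conj (a j) *
    qprod (fun n => ip1 n (h i n) (h j n))) <=
  D ^+ 2 * complex.Re (\sum_i \sum_j a i * Num.conj (a j) *
    qprod (fun n => ip2 n (h i n) (h j n))).
Proof.
move=> d0 dD hd C1 C2 rel12.
pose E : rel 'I_k := fun i j => `[< gram_rel ip2 (h i) (h j) >].
have Es : symmetric E.
  by move=> i j; apply/asboolP/asboolP => /gram_rel_sym.
have Et : transitive E.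
  by move=> j i l /asboolP hij /asboolP hjl; apply/asboolP; exact: gram_rel_trans hij hjl.
pose Q ip N := \sum_i \sum_j a i * Num.conj (a j) * partial_gram h E ip N i j.
have Qcvg ip : (forall i, Cseqs ip (h i)) ->
    (forall i j, E i j = `[< gram_rel ip (h i) (h j) >]) ->
    complex.Re (Q ip N) @[N --> \oo] --> complex.Re (\sum_i \sum_j a i * Num.conj (a j) *
      qprod (fun n => ip n (h i n) (h j n))).
  move=> hC hE; apply: cvg_Re; apply: cvg_finite_sum => i; apply: cvg_finite_sum => j.
  under eq_fun do rewrite mxE hE.
  by apply: cvgM; [exact: cvg_cst|exact: gram_limit].
have h1 := Qcvg ip1 C1 (fun i j => asbool_equiv_eq (iff_sym (rel12 _ _))).
have h2 := Qcvg ip2 C2 (fun i j => erefl).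
apply: (ler_cvg_to h1 (cvgM (cvg_cst (D ^+ 2)) h2)); apply: nearW => N.
have [_ /(_ a)] := psd_partial_gram_le h Es Et N d0 hd.
have -> : \sum_i \sum_j a i * Num.conj (a j) *
    ((\prod_(0 <= n < N) d n ^+ 2)%:C%C *: partial_gram h E ip2 N
      - partial_gram h E ip1 N) i j =
    (\prod_(0 <= n < N) d n ^+ 2)%:C%C * Q ip2 N - Q ip1 N.
  rewrite /Q mulr_sumr -sumrB; apply: eq_bigr => i _.
  rewrite mulr_sumr -sumrB; apply: eq_bigr => j _; rewrite !mxE; ring.
rewrite subr_ge0 lecE => /andP[_ le1]; apply: le_trans le1 _.
have := (psd_partial_gram h Es Et ip2 N).2 a; rewrite -/(Q ip2 N) lecE => /andP[_ q0].
have -> : complex.Re ((\prod_(0 <= n < N) d n ^+ 2)%:C%C * Q ip2 N) =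
    (\prod_(0 <= n < N) d n) ^+ 2 * complex.Re (Q ip2 N).
  by rewrite prodrXl; case: (Q ip2 N) => x y /=; rewrite mul0r subr0.
rewrite ler_wpM2r // ler_pXn2r ?nnegrE ?prodr_ge0 //.
by apply: le_trans (dD N); apply: prodr_ge0.
Qed.

End GramInequality.

(** * Elementary tensors in a complete tensor product *)

Section CompleteTensors.
Context {R : realType} {H : nat -> lmodType R[i]}.
Implicit Types (ip : forall n, {dot H n for Num.conj}) (h y : forall n, H n).

Lemma ct_elem_irr ip (T : complete_tensor ip) h (hC hC' : Cseqs ip h) :
  ct_elem T hC = ct_elem T hC'.
Proof. by rewrite (Prop_irrelevance hC hC'). Qed.

Lemma ct_inj_sum ip (T : complete_tensor ip) k (a : 'I_k -> R[i])
    (F : 'I_k -> ({f | Cseqs ip f} -> R[i])) :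
  (forall i, range (@elem_tensor _ _ ip) (F i)) ->
  ct_inj T (\sum_i a i *: F i) = \sum_i a i *: ct_inj T (F i).
Proof.
have inj0 : ct_inj T 0 = 0.
  have := @ct_linear _ _ _ T (-1) 0 0 (lspan0 _) (lspan0 _).
  by rewrite scaler0 addr0 scaleN1r addNr.
elim: k a F => [|k IH] a F hF; first by rewrite !big_ord0.
rewrite !big_ord_recl ct_linear ?IH //; first exact: lspan_gen.
by exists k, (fun i => a (lift ord0 i)), (fun i => F (lift ord0 i)).
Qed.

Lemma ct_span_dense ip (T : complete_tensor ip) :
  hclosure (ct_ip T)
    (lspan (range (fun z : {h | Cseqs ip h} => ct_elem T (svalP z)))) = setT.
Proof.
rewrite -(ct_dense T); apply/seteqP; split=> x clx e /clx[w]; last first.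
  move=> [_ [k [a [F [hF ->]]]] <-] hx.
  exists (\sum_i a i *: ct_inj T (F i)); last by rewrite -ct_inj_sum.
  exists k, a, (fun i => ct_inj T (F i)); split=> // i.
  by have [[h hC] _ <-] := hF i; exists (exist _ h hC).
move=> [k [a [v [hv ->]]]] hx.
have [z hz] := choice (fun i => let: ex_intro2 z _ e := hv i in ex_intro _ z e).
exists (ct_inj T (\sum_i a i *: elem_tensor (z i))).
  exists (\sum_i a i *: elem_tensor (z i)) => //.
  by exists k, a, (fun i => elem_tensor (z i)); split=> // i; exists (z i).
rewrite ct_inj_sum; last by move=> i; exists (z i).
rewrite (eq_bigr (fun i => a i *: v i)) // => i _; rewrite -hz; case: (z i) => //.
Qed.

Lemma ct_norm_sum ip (T : complete_tensor ip) k (a : 'I_k -> R[i])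
    (h : 'I_k -> forall n, H n) (hC : forall i, Cseqs ip (h i)) :
  ct_norm T (\sum_i a i *: ct_elem T (hC i)) ^+ 2 =
  complex.Re (\sum_i \sum_j a i * Num.conj (a j) *
    qprod (fun n => ip n (h i n) (h j n))).
Proof.
rewrite /ct_norm hnorm_sqr dot_sum; congr (complex.Re _).
by apply: eq_bigr => i _; apply: eq_bigr => j _; rewrite /ct_elem ct_isometry.
Qed.

Lemma ct_norm_elem ip (T : complete_tensor ip) h (hC : Cseqs ip h) a :
  uncond_prod (fun n => hnorm (ip n) (h n)) a -> ct_norm T (ct_elem T hC) = a.
Proof.
move=> ha; rewrite /ct_norm /hnorm /ct_elem ct_isometry /=.
rewrite (qprodE (uncond_prod_dot_self ha)) /= sqrtr_sqr ger0_norm //.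
exact: uncond_prod_hnorm_ge0 ha.
Qed.

End CompleteTensors.

(** * The natural isomorphism *)

Section NaturalIsomorphism.
Context {R : realType} {H : nat -> lmodType R[i]}.
Variables ip ipt : forall n, {dot H n for Num.conj}.
Variables (c : nat -> R) (K : R).
Hypothesis pq : forall n (h : H n),
  hnorm (ip n) h <= hnorm (ipt n) h /\ hnorm (ipt n) h <= c n * hnorm (ip n) h.
Hypothesis c_ge1 : forall n, 1 <= c n.
Hypothesis c_prod : uncond_prod c K.
Hypothesis c_le : forall N, \prod_(0 <= n < N) c n <= K.
Variables (T : complete_tensor ip) (Tt : complete_tensor ipt).

Let CC : Cseqs ipt = Cseqs ip := Cseqs_compare pq c_le.
Let castC h : Cseqs ip h -> Cseqs ipt h.
Proof. by rewrite CC. Qed.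

(** The graph of the natural identification on the span of the elementary
    tensors, as a subspace of the product: this spares checking that the
    identification is well defined there. *)
Let span_graph (x : ct_space T) (y : ct_space Tt) : Prop :=
  lspan (range (fun z : {h | Cseqs ip h} =>
    (ct_elem T (svalP z), ct_elem Tt (castC (svalP z)))
      : (ct_space T * ct_space Tt)%type)) (x, y).

Let span_graphP x y : span_graph x y <->
  exists k (a : 'I_k -> R[i]) (z : 'I_k -> {h | Cseqs ip h}),
    x = \sum_i a i *: ct_elem T (svalP (z i)) /\
    y = \sum_i a i *: ct_elem Tt (castC (svalP (z i))).
Proof.
have pair_sum k (a : 'I_k -> R[i]) (u : 'I_k -> ct_space T) (v : 'I_k -> ct_space Tt) :
    \sum_i a i *: ((u i, v i) : (ct_space T * ct_space Tt)%type) =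
    (\sum_i a i *: u i, \sum_i a i *: v i).
  elim: k a u v => [|k IH] a u v; first by rewrite !big_ord0.
  by rewrite !big_ord_recl IH.
split=> [[k [a [v [hv]]]]|[k [a [z [-> ->]]]]].
  have [z hz] := choice (fun i => let: ex_intro2 z _ e := hv i in ex_intro _ z e).
  rewrite (eq_bigr (fun i => a i *: ((ct_elem T (svalP (z i)),
    ct_elem Tt (castC (svalP (z i)))) : (ct_space T * ct_space Tt)%type))); last first.
    by move=> i _; rewrite -hz.
  by rewrite pair_sum => -[-> ->]; exists k, a, z.
exists k, a, (fun i => (ct_elem T (svalP (z i)), ct_elem Tt (castC (svalP (z i))))).
by rewrite pair_sum; split=> // i; exists (z i).
Qed.

Let span_graph_bounds x y : span_graph x y ->
  ct_norm T x <= ct_norm Tt y <= K * ct_norm T x.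
Proof.
move=> /span_graphP[k [a [z [-> ->]]]].
have K0 : 0 <= K by apply: le_trans ler01 _; exact: K_ge1 c_le.
have C1 i : Cseqs ip (sval (z i)) := svalP (z i).
have C2 i : Cseqs ipt (sval (z i)) := castC (svalP (z i)).
have rel f g := gram_rel_compare pq c_ge1 c_prod c_le f g.
apply/andP; split.
  rewrite -(@ler_pXn2r _ 2) ?nnegrE ?hnorm_ge0 // !ct_norm_sum -[leRHS]mul1r -(expr1n _ 2).
  apply: (@tensor_gram_le _ _ ip ipt (fun=> 1)) => //.
  - by move=> N; rewrite big1.
  - by move=> n v; rewrite mul1r; exact: (pq v).1.
  - by move=> f g; exact: iff_sym (rel f g).
rewrite -(@ler_pXn2r _ 2) ?nnegrE ?mulr_ge0 ?hnorm_ge0 // exprMn !ct_norm_sum.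
apply: (@tensor_gram_le _ _ ipt ip c) => //.
- by move=> n; apply: le_trans ler01 _.
- by move=> n v; exact: (pq v).2.
Qed.

(** The bounds on the span of the elementary tensors make the natural
    identification and its inverse single-valued and bounded there. *)
Lemma natural_isomorphism : exists Phi : {linear ct_space T -> ct_space Tt},
  [/\ natural_ident T Tt Phi, bijective Phi &
    forall x, ct_norm T x <= ct_norm Tt (Phi x) <= K * ct_norm T x].
Proof.
have [|||||Phi [PhiS Phib Phibd]] := @bilipschitz_extension _ _ _
    (ct_ip T) (ct_ip Tt) span_graph K (@ct_hilbert _ _ _ T) (@ct_hilbert _ _ _ Tt).
- move=> t x y x' y' h h'; exact: (lspan_linear t h h').
- by apply: le_trans ler01 _; exact: K_ge1 c_le.
- exact: span_graph_bounds.
- apply/seteqP; split=> // x _; have : setT x by [].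
  rewrite -(ct_span_dense T) => clx e /clx[_ [k [a [v [hv ->]]]] hx].
  exists (\sum_i a i *: v i) => //.
  have [z hz] := choice (fun i => let: ex_intro2 z _ e := hv i in ex_intro _ z e).
  exists (\sum_i a i *: ct_elem Tt (castC (svalP (z i)))); apply/span_graphP.
  by exists k, a, z; split=> //; apply: eq_bigr => i _; rewrite hz.
- apply/seteqP; split=> // y _; have : setT y by [].
  rewrite -(ct_span_dense Tt) => cly e /cly[_ [k [a [v [hv ->]]]] hy].
  exists (\sum_i a i *: v i) => //.
  have [z hz] := choice (fun i => let: ex_intro2 z _ e := hv i in ex_intro _ z e).
  have zC i : Cseqs ip (sval (z i)) by rewrite -CC; exact: svalP.
  exists (\sum_i a i *: ct_elem T (zC i)); apply/span_graphP.
  exists k, a, (fun i => exist _ (sval (z i)) (zC i)).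
  split; apply: eq_bigr => i _; congr (_ *: _).
  by rewrite -hz; exact: ct_elem_irr.
exists Phi; split=> // h hC hCt; apply: PhiS; apply: lspan_gen.
by exists (exist _ h hC) => //; congr (_, _); exact: ct_elem_irr.
Qed.

End NaturalIsomorphism.

(** * Optimality of the constant *)

Section OptimalConstant.
Context {R : realType} {H : nat -> lmodType R[i]}.
Variables ip ipt : forall n, {dot H n for Num.conj}.
Let c n := hconst setT (hnorm (ip n)) (hnorm (ipt n)).
Variable K : R.
Hypothesis H_nontrivial : forall n, exists h : H n, h != 0.
Hypothesis pq : forall n (h : H n),
  hnorm (ip n) h <= hnorm (ipt n) h /\ hnorm (ipt n) h <= c n * hnorm (ip n) h.
Hypothesis c_prod : uncond_prod c K.
Hypothesis c_le : forall N, \prod_(0 <= n < N) c n <= K.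

Let c_ge1 n : 1 <= c n.
Proof. exact: hconst_ge1 (H_nontrivial n) (@pq n). Qed.

(** Membership in the class of [y] is a condition on tails, and the entries of a
    C0-sequence are eventually nonzero. *)
Lemma class_with_prefix (y : forall n, H n) : C0seqs ip y ->
  exists n0, forall N, (n0 <= N)%N -> forall g : forall n, H n,
    (forall n, hnorm (ip n) (g n) = 1) ->
    exists h, [/\ C0_class ip y h, forall n, h n != 0 &
      forall n, (n < N)%N -> h n = g n].
Proof.
move=> y0; have /C0seqsP sy := y0.
have [n0 hn0] := sum_tail_small (fun n => normr_ge0 _) sy ltr01.
have yN0 n : (n0 <= n)%N -> y n != 0.
  move=> n0n; apply/eqP => yn.
  have : \sum_(i <- [:: n]) `|1 - hnorm (ip i) (y i)| < 1.
    by apply: hn0 => // i; rewrite inE => /eqP->.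
  by rewrite big_seq1 yn hnorm0 subr0 normr1 ltxx.
exists n0 => N n0N g g1; exists (fun n => if (n < N)%N then g n else y n); split.
- apply/C0_classP; split.
    apply/C0seqsP; apply: (bounded_sums_tail (k := N) _ _ sy) => n; first exact: normr_ge0.
    by rewrite leqNgt => /negbTE->.
  apply: (bounded_sums_tail (k := N) _ _ (C0seqs_sqr y0)) => n; first exact: normr_ge0.
  rewrite leqNgt => /negbTE->; rewrite dot_hnorm -(rmorph1 (real_complex R)) -rmorphB.
  by rewrite cmod_real.
- move=> n; case: ltnP => h; last by apply: yN0; apply: leq_trans h.
  by rewrite -(hnorm_gt0 (ip n)) g1.
- by move=> n ->.
Qed.

(** The tensor of a sequence [h] in the class of [y] has norm [a], the product of
    the first norms of the entries, and its image has norm [a * r], where [r] is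
    the product of the ratios.  The first [N] ratios can be chosen nearly maximal,
    the others being at least 1, or nearly minimal, the others being at most
    [c n]. *)
Lemma optimal_constant (T : complete_tensor ip) (Tt : complete_tensor ipt)
    (Phi : {linear ct_space T -> ct_space Tt}) (A : set (ct_space T))
    (y : forall n, H n) :
  natural_ident T Tt Phi ->
  (forall x, ct_norm T x <= ct_norm Tt (Phi x) <= K * ct_norm T x) ->
  C0seqs ip y ->
  (forall h (hC : Cseqs ip h), C0_class ip y h -> A (ct_elem T hC)) ->
  hconst A (ct_norm T) (ct_norm Tt \o Phi) = K.
Proof.
move=> PhiE Phib y0 Ay; apply: hconst_eq.
  by split=> x _ /=; have /andP[] := Phib x; rewrite ?mul1r.
move=> M N' [hM hN].
have [n0 hn0] := class_with_prefix y0.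
have K1 : 1 <= K := K_ge1 c_le.
have K0 : 0 < K := lt_le_trans ltr01 K1.
have P0 N : 0 < \prod_(0 <= n < N) c n.
  by apply: prodr_gt0 => n _; exact: lt_le_trans (c_ge1 n).
(* [r] is the product of the ratios of a sequence that starts with the unit
   vectors [g n]; the last bound on [r] estimates the ratios after [N] by [c n]. *)
have witness N g : (n0 <= N)%N -> (forall n, hnorm (ip n) (g n) = 1) ->
    exists r, [/\ 1 <= M * r, r <= N', \prod_(0 <= n < N) hnorm (ipt n) (g n) <= r &
      (\prod_(0 <= n < N) c n) * r <= \prod_(0 <= n < N) hnorm (ipt n) (g n) * K].
  move=> n0N g1; have [h [hy hN0 hg]] := hn0 N n0N g g1.
  have hC : Cseqs ip h by apply: C0seqs_Cseqs; exact: hy.1.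
  have hCt : Cseqs ipt h by rewrite (Cseqs_compare pq c_le).
  have [a ha] := hC.
  have [r [hr r1 rle]] := uncond_prod_ratio pq c_le hN0.
  have hb : uncond_prod (fun n => hnorm (ipt n) (h n)) (a * r).
    have := uncond_prodM ha hr.
    by under eq_fun do rewrite mulrC divfK ?hnorm_eq0 //.
  have a0 : 0 < a.
    apply: (uncond_prod_gt0 _ _ ha); last exact/C0seqsP/hy.1.
    by move=> n; rewrite hnorm_gt0.
  have Th := ct_norm_elem T hC ha; have Tth := ct_norm_elem Tt hCt hb.
  have prefix_ratio : \prod_(0 <= n < N) (hnorm (ipt n) (h n) / hnorm (ip n) (h n)) =
      \prod_(0 <= n < N) hnorm (ipt n) (g n).
    by apply: eq_big_nat => n /andP[_ nN]; rewrite hg // g1 divr1.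
  exists r; split.
  - have := hM _ (Ay h hC hy); rewrite /= (PhiE h hC hCt) Th Tth mulrCA.
    by rewrite -{1}[a]mulr1 ler_pM2l.
  - have := hN _ (Ay h hC hy); rewrite /= (PhiE h hC hCt) Th Tth [N' * a]mulrC.
    by rewrite ler_pM2l.
  - by rewrite -prefix_ratio.
  apply: (ler_cvg_to (cvgM (cvg_cst _) (uncond_prod_cvg hr)) (cvg_cst _)).
  exists N => // L /= NL.
  rewrite [X in _ * X](big_cat_nat (n := N)) //= prefix_ratio mulrCA ler_wpM2l //.
    by apply: prodr_ge0 => n _; exact: hnorm_ge0.
  apply: le_trans (c_le L); rewrite [leRHS](big_cat_nat (n := N)) //= ler_pM2l //.
  apply: ler_prod => n _; have /andP[h1 ->] := ratio_bounds pq (hN0 n).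
  by rewrite (le_trans ler01).
have scale t N (x : nat -> R) :
    \prod_(0 <= n < N) (t * x n) = t ^+ N * \prod_(0 <= n < N) x n.
  by rewrite big_split /= prodr_const_nat subn0.
have le_of_partial (b : R) : (forall N, (n0 <= N)%N -> \prod_(0 <= n < N) c n <= b) -> K <= b.
  move=> hb; apply: (ler_cvg_to (uncond_prod_cvg c_prod) (cvg_cst b)).
  by exists n0 => // N /hb.
have N'K : K <= N'.
  apply: le_of_partial => N n0N; apply: (@le_of_expr_le _ _ _ N); first exact: ltW.
  move=> t t01.
  have ex_g n := almost_maximal (H_nontrivial n) (@pq n) t01.
  pose g n := sval (cid (ex_g n)).
  have hg n : hnorm (ip n) (g n) = 1 /\ t * c n <= hnorm (ipt n) (g n).
    exact: (svalP (cid (ex_g n))).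
  have [r [_ rN' gr _]] := witness N g n0N (fun n => (hg n).1).
  apply: le_trans (le_trans gr rN'); rewrite -scale; apply: ler_prod => n _.
  rewrite (hg n).2 andbT mulr_ge0 //; first by have /andP[/ltW] := t01.
  exact: le_trans ler01 (c_ge1 n).
have M1 : 1 <= M.
  rewrite -(ler_pM2r K0) mul1r.
  apply: le_of_partial => N n0N; apply: (@le_of_expr_le _ _ _ N); first exact: ltW.
  move=> t t01; have /andP[/ltW t0 _] := t01.
  have ex_g n := almost_minimal (H_nontrivial n) (@pq n) t01.
  pose g n := sval (cid (ex_g n)).
  have hg n : hnorm (ip n) (g n) = 1 /\ t * hnorm (ipt n) (g n) <= 1.
    exact: (svalP (cid (ex_g n))).
  have [r [Mr _ gr Pr]] := witness N g n0N (fun n => (hg n).1).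
  have g1 n : 1 <= hnorm (ipt n) (g n) by rewrite -{1}(hg n).1; exact: (pq (g n)).1.
  have G1 : 1 <= \prod_(0 <= n < N) hnorm (ipt n) (g n).
    exact: (prod_ge1 _ g1).
  have r0 : 0 < r by apply: lt_le_trans gr; apply: lt_le_trans G1.
  have M0 : 0 <= M by rewrite -(pmulr_lge0 _ r0) (le_trans ler01).
  have tG : t ^+ N * \prod_(0 <= n < N) hnorm (ipt n) (g n) <= 1.
    rewrite -scale; apply: prodr_ile1 => n _.
    by rewrite (hg n).2 andbT mulr_ge0 // hnorm_ge0.
  have tN0 : 0 <= t ^+ N by rewrite exprn_ge0.
  have step1 : t ^+ N * \prod_(0 <= n < N) c n <=
      t ^+ N * \prod_(0 <= n < N) c n * (M * r).
    by rewrite ler_peMr // mulr_ge0 // ltW.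
  apply: le_trans step1 _.
  have -> : t ^+ N * \prod_(0 <= n < N) c n * (M * r) =
      M * (t ^+ N * (\prod_(0 <= n < N) c n * r)) by ring.
  rewrite ler_wpM2l //; apply: le_trans (ler_wpM2l tN0 Pr) _.
  by rewrite mulrA -[leRHS]mul1r ler_wpM2r // ltW.
by rewrite -[K]mul1r ler_pM // ltW.
Qed.

End OptimalConstant.

(** * Finite and infinite products of the constants *)

Lemma unit_sequence {R : realType} {H : nat -> lmodType R[i]}
    (ip : forall n, {dot H n for Num.conj}) :
  (forall n, exists h : H n, h != 0) ->
  exists y, C0seqs ip y /\ forall n, hnorm (ip n) (y n) = 1.
Proof.
move=> nz; have unit n : exists h, hnorm (ip n) h = 1.
  by have [h h0] := nz n; have [h' [h'1 _]] := normalize (ip n) (ip n) h0; exists h'.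
exists (fun n => sval (cid (unit n))).
have y1 n : hnorm (ip n) (sval (cid (unit n))) = 1 by exact: svalP (cid (unit n)).
split=> //; apply/C0seqsP; exists 0 => N.
by rewrite big1 // => n _; rewrite y1 subrr normr0.
Qed.

(** With unit vectors [g n] whose new norm is at least [(1 + c n) / 2], hence at
    least the square root of [c n], the new norms have an infinite product. *)
Lemma Cseqs_neq {R : realType} {H : nat -> lmodType R[i]}
    (ip ipt : forall n, {dot H n for Num.conj})
    (c := fun n => hconst setT (hnorm (ip n)) (hnorm (ipt n))) :
  (forall n, exists h : H n, h != 0) ->
  (forall n (h : H n), hnorm (ip n) h <= hnorm (ipt n) h /\
     hnorm (ipt n) h <= c n * hnorm (ip n) h) ->
  (forall B, exists N, B < \prod_(0 <= n < N) c n) ->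
  Cseqs ipt <> Cseqs ip.
Proof.
move=> nz pq unb CC.
have c1 n : 1 <= c n := hconst_ge1 (nz n) (@pq n).
have ex_g n : exists h, hnorm (ip n) h = 1 /\ (1 + c n) / 2 <= hnorm (ipt n) h.
  have [ceq|cneq] := eqVneq (c n) 1.
    have t01 : 0 < (2^-1 : R) < 1 by rewrite invr_gt0 ltr0n /= invf_lt1 // ltr1n.
    have [h [h1 _]] := almost_maximal (nz n) (@pq n) t01.
    exists h; split=> //; rewrite ceq -{3}h1; have := (pq n h).1; rewrite h1; lra.
  have cgt : 1 < c n by rewrite lt_def cneq c1.
  have t01 : 0 < (1 + c n) / (2 * c n) < 1.
    by rewrite divr_gt0 ?ltr_pdivrMr; first lra; lra.
  have [h [h1 h2]] := almost_maximal (nz n) (@pq n) t01.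
  exists h; split=> //; apply: le_trans h2; rewrite -/(c n) le_eqVlt; apply/orP; left.
  by apply/eqP; field; apply/eqP; lra.
pose g n := sval (cid (ex_g n)).
have hg n : hnorm (ip n) (g n) = 1 /\ (1 + c n) / 2 <= hnorm (ipt n) (g n).
  exact: svalP (cid (ex_g n)).
have : Cseqs ip g.
  apply: C0seqs_Cseqs; apply/C0seqsP; exists 0 => N.
  by rewrite big1 // => n _; rewrite (hg n).1 subrr normr0.
rewrite -CC => -[b /uncond_prod_cvg hb].
have [N] := unb (b ^+ 2); apply/negP; rewrite -leNgt.
apply: (ler_cvg_to (cvg_cst _) (cvgM hb hb)); exists N => // L /= NL.
rewrite -big_split /=.
have cg n : 0 <= c n <= hnorm (ipt n) (g n) * hnorm (ipt n) (g n).
  have := (hg n).2; have := c1 n; move: (c n) (hnorm _ _) => x q x1 xq.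
  apply/andP; split; first lra.
  apply: (@le_trans _ _ ((1 + x) / 2 * ((1 + x) / 2))).
    by have := sqr_ge0 (1 - x); rewrite expr2; lra.
  by apply: ler_pM => //; lra.
apply: (@le_trans _ _ (\prod_(0 <= n < L) c n)); last by apply: ler_prod.
rewrite /index_iota !subn0; apply: prod_ge1_subset; rewrite ?iota_uniq //.
by move=> i; rewrite !mem_iota !add0n /= => /leq_trans; apply.
Qed.

Unset Implicit Arguments.

Theorem proposition6p3 (R : realType) (H : nat -> lmodType R[i])
    (ip ipt : forall n : nat, {dot H n for Num.conj})
    (H_hilbert : forall n, hilbert (ip n))
    (H_nontrivial : forall n, exists h : H n, h != 0)
    (ipt_equiv : forall n,
       equiv_norms setT (hnorm (ip n)) (hnorm (ipt n)))
    (ipt_bounds : forall n (h : H n),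
       hnorm (ip n) h <= hnorm (ipt n) h /\
       hnorm (ipt n) h <=
         hconst setT (hnorm (ip n)) (hnorm (ipt n)) * hnorm (ip n) h) :
  let C : \bar R :=
    eprod (fun n => hconst setT (hnorm (ip n)) (hnorm (ipt n))) in
  [/\ (1 <= C)%E,
      Cseqs ipt = Cseqs ip <-> (C < +oo)%E
    & (C < +oo)%E ->
      C0_classes ipt = C0_classes ip /\
      forall (T : complete_tensor ip) (Tt : complete_tensor ipt),
      exists Phi : {linear ct_space T -> ct_space Tt},
      [/\ natural_ident T Tt Phi /\ bijective Phi,
          equiv_norms setT (ct_norm T) (ct_norm Tt \o Phi),
          (hconst setT (ct_norm T) (ct_norm Tt \o Phi))%:E = C
        & forall y : (forall n, H n), C0seqs ip y ->
          [/\ Phi @` incomplete_tensor T y = incomplete_tensor Tt y,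
              equiv_norms (incomplete_tensor T y)
                (ct_norm T) (ct_norm Tt \o Phi)
            & (hconst (incomplete_tensor T y)
                (ct_norm T) (ct_norm Tt \o Phi))%:E = C]]].
Proof.
move=> C; pose c n := hconst setT (hnorm (ip n)) (hnorm (ipt n)).
have c1 n : 1 <= c n := hconst_ge1 (H_nontrivial n) (ipt_bounds n).
have [[K [CE cp K1 cle]]|[CE unb]] := eprod_ge1 c1; last first.
  split; rewrite /C CE ?leey //; split=> // CC.
  by have := Cseqs_neq H_nontrivial ipt_bounds unb.
have K0 : 0 < K := lt_le_trans ltr01 K1.
split; first by rewrite /C CE lee_fin.
  by split=> _; [rewrite /C CE ltry|exact: Cseqs_compare ipt_bounds cle].
have C0E := C0seqs_compare ipt_bounds c1 cp cle.
have classE y : C0seqs ip y -> C0_class ipt y = C0_class ip y.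
  exact: (C0_class_compare ipt_bounds c1 cp cle).
move=> _; split; first by rewrite /C0_classes C0E; exact: eq_imagel.
move=> T Tt.
have [Phi [PhiE Phib Phibd]] := natural_isomorphism ipt_bounds c1 cp cle T Tt.
have bounds A : norm_bounds A (ct_norm T) (ct_norm Tt \o Phi) 1 K.
  by split=> x _ /=; have /andP[] := Phibd x; rewrite ?mul1r.
have optimal := optimal_constant H_nontrivial ipt_bounds cp cle PhiE Phibd.
exists Phi; split=> //; first by exists 1, K.
  have [y [y0 _]] := unit_sequence ip H_nontrivial.
  by rewrite /C CE (optimal setT y).
(* The generators of the closed span determine its constant. *)
move=> y y0; split; first 1 last.
- by exists 1, K.
- rewrite /C CE (optimal _ y) // => h hC hy e e0.
  exists (ct_elem T hC); last by rewrite subrr hnorm0.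
  by apply: lspan_gen; exists h, hC.
rewrite /incomplete_tensor (image_closed_span _ Phib Phibd K0); congr (hclosure _ (lspan _)).
have CC := Cseqs_compare ipt_bounds cle.
apply/seteqP; split=> t.
  move=> [_ [h [hC [hy ->]]] <-].
  have hCt : Cseqs ipt h by rewrite CC.
  by exists h, hCt; rewrite (classE y y0); split=> //; exact: PhiE.
move=> [h [hCt [hy ->]]]; have hC : Cseqs ip h by rewrite -CC.
exists (ct_elem T hC); last exact: PhiE.
by exists h, hC; rewrite -(classE y y0).
Qed.
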